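(* For all $\ell,n\in\mathbb{N}$ with $n\ge2$ and all $\boldsymbol{h}\in\mathcal{I}_n$, $$\|p^{(\ell)}\|_\infty\le m_{\ell,n}\,\|p\|_\infty\qquad\text{for all }p\in\mathcal{RP}_{\boldsymbol{h}},$$ where equality is attained at the polynomial $T_{\boldsymbol{e}}(t)=e^{-t}R_{n-1}(t)$, and $$\sum_{j=0}^{\ell}\Bigl(1-\frac{j}{2(n-1)}\Bigr)\frac{8^j\binom{n-1}{j}\binom{\ell}{j}}{\binom{2j}{j}}\ \le\ m_{\ell,n}\ \le\ \sum_{j=0}^{\ell}\frac{8^j\binom{n-1}{j}\binom{\ell}{j}}{\binom{2j}{j}}$$ (all terms with $j\ge n$ being zero).
   Context: $\|f\|_\infty=\sup_{t\ge0}|f(t)|$; $\mathcal{I}_n=(0,1]^n$; $\boldsymbol{e}=(1,\dots,1)$. For $\boldsymbol{h}=(h_1,\dots,h_n)$ with positive entries, $E_{\boldsymbol{h}}$ consists of the functions $e^{-h_kt}$, with the convention that a value $h$ of multiplicity $r$ contributes $e^{-ht},te^{-ht},\dots,t^{r-1}e^{-ht}$; $\mathcal{RP}_{\boldsymbol{h}}$ is the space of real linear combinations of these functions on $[0,\infty)$. $m_\ell(\boldsymbol{h})=\max\{\|p^{(\ell)}\|_\infty: p\in\mathcal{RP}_{\boldsymbol{h}},\|p\|_\infty\le1\}$, $m_{\ell,n}=\max_{\boldsymbol{h}\in\mathcal{I}_n}m_\ell(\boldsymbol{h})$. $R_{n-1}$ is the Chebyshev algebraic polynomial of degree $n-1$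 with Laguerre weight $e^{-t}$: the degree $n-1$ polynomial such that $e^{-t}R_{n-1}(t)$ has sup-norm $1$ on $[0,\infty)$ and an alternance of $n$ points on $[0,\infty)$ including $0$. $\binom{m}{0}=1$ for $m\ge0$. *)

(* Defs.v *)
From Stdlib Require Import Reals.
From Coquelicot Require Import Coquelicot.
Open Scope R_scope.

Fixpoint rsum (f : nat -> R) (n : nat) : R :=
  match n with O => 0 | S k => rsum f k + f k end.

Fixpoint binom (m k : nat) : nat :=
  match m, k with
  | _, O => 1%nat
  | O, S _ => 0%nat
  | S m', S k' => (binom m' k' + binom m' (S k'))%nat
  end.

Definition supnorm (f : R -> R) : R :=
  real (Lub_Rbar (fun y => exists t, 0 <= t /\ y = Rabs (f t))).

Definition inI (n : nat) (h : nat -> R) : Prop :=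
  forall i, (i < n)%nat -> 0 < h i <= 1.

Fixpoint mult (h : nat -> R) (x : R) (i : nat) : nat :=
  match i with
  | O => O
  | S j => (mult h x j + (if Req_EM_T (h j) x then 1 else 0))%nat
  end.

(* basis function attached to index i: t^c e^{-h_i t}, c = number of earlier
   indices carrying the same value; this realizes the multiplicity convention. *)
Definition basis (h : nat -> R) (i : nat) (t : R) : R :=
  t ^ (mult h (h i) i) * exp (- (h i) * t).

Definition inRP (n : nat) (h : nat -> R) (p : R -> R) : Prop :=
  exists a : nat -> R, forall t, p t = rsum (fun i => a i * basis h i t) n.

Definition m_l (l n : nat) (h : nat -> R) : R :=
  real (Lub_Rbar (fun y => exists p, inRP n h p /\ supnorm p <= 1 /\
                                   y = supnorm (Derive_n p l))).

Definition m_ln (l n : nat) : R :=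
  real (Lub_Rbar (fun y => exists h, inI n h /\ y = m_l l n h)).

Definition polyv (n : nat) (c : nat -> R) (t : R) : R :=
  rsum (fun k => c k * t ^ k) n.

(* c is the coefficient vector of a Chebyshev polynomial R_{n-1} with Laguerre
   weight e^{-t}: degree exactly n-1, ||e^{-t} R_{n-1}|| = 1, and an alternance
   of n points 0 = t_0 < t_1 < ... < t_{n-1}. *)
Definition is_chebR (n : nat) (c : nat -> R) : Prop :=
  c (n - 1)%nat <> 0 /\
  supnorm (fun t => exp (- t) * polyv n c t) = 1 /\
  exists (tt : nat -> R) (s : R),
    (s = 1 \/ s = -1) /\ tt O = 0 /\
    (forall i, (S i < n)%nat -> tt i < tt (S i)) /\
    (forall i, (i < n)%nat -> exp (- tt i) * polyv n c (tt i) = s * (-1) ^ i).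

(* Main.v *)
Require Import Defs.
From Stdlib Require Import Reals Factorial Lra Lia Psatz Classical ClassicalEpsilon.
From Coquelicot Require Import Coquelicot.
Open Scope R_scope.

(* Since translations preserve RP_h, everything reduces to bounding p^(l)(0) by the
   values of p at n nodes 0 = t_0 < ... < t_(n-1). For distinct exponents H_j there is a
   formula p^(l)(0) = sum_i C_i p(t_i), exact on the exp (- H_j t). The coefficients are
   those of an interpolation of lam^l, at lam = H_j, by the functions exp (- t_i lam). By
   Rolle's theorem (with D + t_i killing exp (- t_i lam)) they alternate in sign, and each
   |C_i| grows when one of the H_j grows; multiple exponents are reached by a limit. Hence
   sum |C_i| is largest for h = (1,...,1), where an alternating Q = exp (- t) q of height
   at least 1 at the nodes gives sum |C_i| <= |Q^(l)(0)|. The Chebyshev polynomial then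
   yields m_ln = |T^(l)(0)|, and Q(x^2 / 2) = the Hermite function of degree 2(n-1),
   whose successive maxima increase by Sonin's argument, yields the upper bound. The lower
   bound comes from the derivative of the Hermite function of degree 2n-3, which is
   largest at 0. *)

(** No confluent formula is ever built. A formula exact at exponents clustered near a multiple one
    is, by Rolle's theorem in [lam], exact on [t^k * exp (- xi * t)] for some nearby [xi]. Hence it
    is exact for a function with slightly moved exponents, whose node values and [l]-th derivative
    differ by less than [eta] from the given ones. These errors enter in proportion to
    [C = sum |C_i|]: one finds [|p^(l) (s)| <= eta + (1 + eta) * C] and
    [(1 - eta) * C <= |Q^(l) (0)| + eta], and [C] is eliminated without an a priori bound on the
    weights. The second estimate holds because [C_i] and [Q (t_i)] alternate together, so the terms
    of [sum C_i Q (t_i)] have one sign. All sign arguments use weak inequalities: a zero counts as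
    having either sign, so interpolation points can take part in an alternation. *)

(** * Finite sums, finite choice and iterated Rolle *)

Lemma rsum_ext (f g : nat -> R) n :
  (forall i, (i < n)%nat -> f i = g i) -> rsum f n = rsum g n.
Proof.
  intros H; induction n as [|n IH]; simpl; [reflexivity|].
  rewrite IH, H; auto.
Qed.

Lemma rsum_plus (f g : nat -> R) n :
  rsum (fun i => f i + g i) n = rsum f n + rsum g n.
Proof. induction n as [|n IH]; simpl; [ring|rewrite IH; ring]. Qed.

Lemma rsum_scal (a : R) (f : nat -> R) n :
  rsum (fun i => a * f i) n = a * rsum f n.
Proof. induction n as [|n IH]; simpl; [ring|rewrite IH; ring]. Qed.

Lemma rsum_minus (f g : nat -> R) n :
  rsum (fun i => f i - g i) n = rsum f n - rsum g n.
Proof. induction n as [|n IH]; simpl; [ring|rewrite IH; ring]. Qed.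

Lemma rsum_0 (f : nat -> R) n :
  (forall i, (i < n)%nat -> f i = 0) -> rsum f n = 0.
Proof.
  intros H; induction n as [|n IH]; simpl; [reflexivity|].
  rewrite IH, H by auto; ring.
Qed.

Lemma rsum_le (f g : nat -> R) n :
  (forall i, (i < n)%nat -> f i <= g i) -> rsum f n <= rsum g n.
Proof.
  intros H; induction n as [|n IH]; simpl; [lra|].
  assert (A := H n (Nat.lt_succ_diag_r n)).
  assert (B : rsum f n <= rsum g n) by auto. lra.
Qed.

Lemma rsum_ge_term (f : nat -> R) n i :
  (i < n)%nat -> (forall j, (j < n)%nat -> 0 <= f j) -> f i <= rsum f n.
Proof.
  intros Hi H; induction n as [|n IH]; [lia|]; simpl.
  assert (P : 0 <= rsum f n).
  { rewrite <- (rsum_0 (fun _ => 0) n) by auto. apply rsum_le; auto. }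
  assert (A := H n (Nat.lt_succ_diag_r n)).
  destruct (Nat.eq_dec i n) as [->|]; [lra|].
  assert (f i <= rsum f n) by (apply IH; [lia|auto]). lra.
Qed.

Lemma rsum_lt (f g : nat -> R) n i :
  (i < n)%nat -> (forall j, (j < n)%nat -> f j <= g j) -> f i < g i ->
  rsum f n < rsum g n.
Proof.
  intros Hi H L.
  assert (A := rsum_ge_term (fun j => g j - f j) n i Hi).
  simpl in A; rewrite rsum_minus in A.
  assert (g i - f i <= rsum g n - rsum f n).
  { apply A; intros j Hj; specialize (H j Hj); lra. }
  lra.
Qed.

Lemma Rabs_rsum (f : nat -> R) n :
  Rabs (rsum f n) <= rsum (fun i => Rabs (f i)) n.
Proof.
  induction n as [|n IH]; simpl; [rewrite Rabs_R0; lra|].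
  eapply Rle_trans; [apply Rabs_triang|lra].
Qed.

Lemma rsum_S_l (f : nat -> R) n :
  rsum f (S n) = f O + rsum (fun i => f (S i)) n.
Proof. induction n as [|n IH]; simpl in *; [ring|rewrite IH; ring]. Qed.

(** The increasing enumeration of the indices other than [i]; it serves to split one term off a sum
    and to drop one node from a family. *)
Definition skip (i j : nat) : nat := if (j <? i)%nat then j else S j.

Lemma rsum_skip (f : nat -> R) n i :
  (i <= n)%nat -> rsum f (S n) = f i + rsum (fun j => f (skip i j)) n.
Proof.
  induction n as [|n IH]; intros Hi.
  - replace i with O by lia; simpl; ring.
  - destruct (Nat.eq_dec i (S n)) as [->|Hn].
    + change (rsum f (S (S n))) with (rsum f (S n) + f (S n)).
      rewrite Rplus_comm; f_equal. apply rsum_ext; intros j Hj.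
      unfold skip. destruct (Nat.ltb_spec j (S n)); [reflexivity|lia].
    + change (rsum f (S (S n))) with (rsum f (S n) + f (S n)).
      assert (E : skip i n = S n).
      { unfold skip. destruct (Nat.ltb_spec n i); [lia|reflexivity]. }
      rewrite IH by lia. cbn [rsum]. rewrite E. ring.
Qed.

Lemma finite_choice {A : Type} (P : nat -> A -> Prop) (a0 : A) n :
  (forall i, (i < n)%nat -> exists x, P i x) ->
  exists f : nat -> A, forall i, (i < n)%nat -> P i (f i).
Proof.
  induction n as [|n IH]; intros H; [exists (fun _ => a0); intros; lia|].
  destruct IH as [f Hf]; [auto|].
  destruct (H n) as [x Hx]; [lia|].
  exists (fun i => if Nat.eq_dec i n then x else f i).
  intros i Hi. destruct (Nat.eq_dec i n) as [->|]; [exact Hx|apply Hf; lia].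
Qed.

Lemma finite_pos_bound (P : nat -> R -> Prop) n :
  (forall i r r', P i r -> 0 < r' <= r -> P i r') ->
  (forall i, (i < n)%nat -> exists r, 0 < r /\ P i r) ->
  exists r, 0 < r /\ forall i, (i < n)%nat -> P i r.
Proof.
  intros Hm; induction n as [|n IH]; intros H.
  - exists 1; split; [lra|intros; lia].
  - destruct IH as [r [r0 Hr]]; [auto|].
    destruct (H n) as [r' [r0' Hr']]; [lia|].
    assert (M : 0 < Rmin r r') by (apply Rmin_glb_lt; auto).
    assert (M1 := Rmin_l r r'). assert (M2 := Rmin_r r r').
    exists (Rmin r r'); split; [auto|].
    intros i Hi; destruct (Nat.eq_dec i n) as [->|].
    + apply (Hm _ r'); auto.
    + apply (Hm _ r); [apply Hr; lia|auto].
Qed.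

Lemma increasing_lt (x : nat -> R) n :
  (forall j, (S j < n)%nat -> x j < x (S j)) ->
  forall i j, (i < j < n)%nat -> x i < x j.
Proof.
  intros H i j; induction j as [|j IH]; intros Hij; [lia|].
  destruct (Nat.eq_dec i j) as [->|]; [apply H; lia|].
  apply Rlt_trans with (x j); [apply IH; lia|apply H; lia].
Qed.

Lemma is_derive_rsum (f f' : nat -> R -> R) n x :
  (forall i, (i < n)%nat -> is_derive (f i) x (f' i x)) ->
  is_derive (fun x => rsum (fun i => f i x) n) x (rsum (fun i => f' i x) n).
Proof.
  induction n as [|n IH]; intros H; simpl.
  - apply (is_derive_const 0).
  - apply (is_derive_plus (V := R_NormedModule)); auto.
Qed.

Lemma is_derive_continuity f x l : is_derive f x l -> continuity_pt f x.
Proof.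
  intros H; apply derivable_continuous_pt; exists l. now apply is_derive_Reals.
Qed.

Lemma MVT_is_derive (f f' : R -> R) a b :
  a < b -> (forall x, a <= x <= b -> is_derive f x (f' x)) ->
  exists c, f b - f a = f' c * (b - a) /\ a < c < b.
Proof.
  intros Hab H. apply MVT_cor2; [exact Hab|].
  intros c Hc; apply is_derive_Reals; auto.
Qed.

Lemma iterated_rolle (k : nat) : forall (F : nat -> R -> R) (x : nat -> R),
  (forall j x, is_derive (F j) x (F (S j) x)) ->
  (forall j, (j < k)%nat -> x j < x (S j)) ->
  (forall j, (j <= k)%nat -> F O (x j) = 0) ->
  exists xi, x O <= xi <= x k /\ F k xi = 0.
Proof.
  induction k as [|k IH]; intros F x HF Hx H0.
  - exists (x O); split; [lra|apply H0; lia].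
  - destruct (finite_choice
      (fun j y => x j < y < x (S j) /\ F 1%nat y = 0) 0 (S k)) as [y Hy].
    { intros j Hj.
      destruct (MVT_is_derive (F O) (F 1%nat) (x j) (x (S j))) as [c [E Hc]];
        [apply Hx; lia|intros; apply HF|].
      exists c; split; [exact Hc|].
      rewrite !H0 in E by lia.
      symmetry in E; replace (0 - 0) with 0 in E by ring.
      apply Rmult_integral in E; destruct E; [assumption|lra]. }
    destruct (IH (fun j => F (S j)) y) as [xi [Hxi E]].
    + intros; apply HF.
    + intros j Hj; assert (A := Hy j ltac:(lia)); assert (B := Hy (S j) ltac:(lia)).
      lra.
    + intros j Hj; apply Hy; lia.
    + exists xi; split; [|exact E].
      assert (A := Hy O ltac:(lia)); assert (B := Hy k ltac:(lia)).
      lra.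
Qed.

(** * Mixed derivatives of exponentials *)

(* [dexp k l lam t] is the mixed derivative of [exp (- lam * t)],
   of order [k] in [lam] and [l] in [t]. *)
Fixpoint dexp (k l : nat) (lam t : R) : R :=
  match l with
  | O => (- t) ^ k * exp (- lam * t)
  | S l' => - lam * dexp k l' lam t - INR k * dexp (pred k) l' lam t
  end.

Lemma is_derive_dexp_t l : forall k lam t,
  is_derive (fun t => dexp k l lam t) t (dexp k (S l) lam t).
Proof.
  induction l as [|l IH]; intros k lam t.
  - simpl. auto_derive; [auto|]. destruct k; simpl; ring.
  - change (dexp k (S (S l)) lam t) with
      (- lam * dexp k (S l) lam t - INR k * dexp (pred k) (S l) lam t).
    apply (is_derive_minus (V := R_NormedModule)
      (fun t => - lam * dexp k l lam t) (fun t => INR k * dexp (pred k) l lam t));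
    apply is_derive_scal; apply IH.
Qed.

(** The recursion of [dexp] in [l] is Leibniz's rule for the [k]-th derivative in [lam] of
    [- lam * g lam]. For [k = 0] the value [pred 0 = 0] is harmless, being multiplied by [INR 0]. *)
Lemma is_derive_dexp_lam l : forall k lam t,
  is_derive (fun lam => dexp k l lam t) lam (dexp (S k) l lam t).
Proof.
  induction l as [|l IH]; intros k lam t.
  - simpl. auto_derive; [auto|]. ring.
  - cbn [dexp].
    replace (- lam * dexp (S k) l lam t - INR (S k) * dexp (pred (S k)) l lam t)
      with ((- 1 * dexp k l lam t + - lam * dexp (S k) l lam t)
            - INR k * dexp k l lam t) by (rewrite S_INR; simpl; ring).
    apply (is_derive_minus (V := R_NormedModule)
      (fun lam => - lam * dexp k l lam t) (fun lam => INR k * dexp (pred k) l lam t)).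
    + apply (is_derive_mult (fun lam => - lam) (fun lam => dexp k l lam t)).
      * auto_derive; [auto|ring].
      * apply IH.
      * intros; apply Rmult_comm.
    + destruct k as [|k].
      * simpl INR. replace (0 * dexp 0 l lam t) with 0 by ring.
        apply (is_derive_ext (fun _ => 0)); [intros; simpl; ring|].
        apply (is_derive_const 0).
      * apply is_derive_scal; apply IH.
Qed.

Lemma dexp_0_l l lam t : dexp 0 l lam t = (- lam) ^ l * exp (- lam * t).
Proof. induction l as [|l IH]; simpl in *; [ring|rewrite IH; ring]. Qed.

Lemma Derive_n_chain (f : R -> R) (F : nat -> R -> R) :
  (forall t, f t = F O t) ->
  (forall l t, is_derive (F l) t (F (S l) t)) ->
  forall l t, Derive_n f l t = F l t.
Proof.
  intros H0 H; induction l as [|l IH]; intros t; [apply H0|].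
  simpl. rewrite (Derive_ext _ (F l)) by exact IH.
  apply is_derive_unique, H.
Qed.

Lemma Derive_n_quasipoly (a h : nat -> R) (k : nat -> nat) n l t :
  Derive_n (fun t => rsum (fun i => a i * (t ^ k i * exp (- h i * t))) n) l t
  = rsum (fun i => a i * ((-1) ^ k i * dexp (k i) l (h i) t)) n.
Proof.
  apply (Derive_n_chain _
    (fun l t => rsum (fun i => a i * ((-1) ^ k i * dexp (k i) l (h i) t)) n)).
  - intros u; apply rsum_ext; intros i _. simpl dexp.
    replace u with (-1 * - u) at 1 by ring. rewrite Rpow_mult_distr. ring.
  - clear l t; intros l t.
    apply (is_derive_rsum
      (fun i t => a i * ((-1) ^ k i * dexp (k i) l (h i) t))
      (fun i t => a i * ((-1) ^ k i * dexp (k i) (S l) (h i) t))).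
    intros i _; apply is_derive_scal, is_derive_scal, is_derive_dexp_t.
Qed.

(** * Alternations of exponential sums *)

Fixpoint rprod (f : nat -> R) (n : nat) : R :=
  match n with O => 1 | S k => rprod f k * f k end.

Lemma rprod_ext f g n :
  (forall i, (i < n)%nat -> f i = g i) -> rprod f n = rprod g n.
Proof.
  intros H; induction n as [|n IH]; simpl; [reflexivity|].
  rewrite IH, H; auto.
Qed.

Lemma rprod_neq0 f n : (forall i, (i < n)%nat -> f i <> 0) -> rprod f n <> 0.
Proof.
  intros H; induction n as [|n IH]; simpl; [lra|].
  apply Rmult_integral_contrapositive; split; auto.
Qed.

Lemma sign_sqr n : (-1) ^ n * (-1) ^ n = 1.
Proof. rewrite <- pow_add. replace (n + n)%nat with (2 * n)%nat by lia. apply pow_1_even. Qed.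

Lemma Rabs_sign n : Rabs ((-1) ^ n) = 1.
Proof. apply pow_1_abs. Qed.

(** Exactly the [i] factors with [j < i] are negative; after [r] factors their number is
    [Nat.min r i]. *)
Lemma rprod_skip_sign (t : nat -> R) m i :
  (i <= m)%nat -> (forall j, (S j < S m)%nat -> t j < t (S j)) ->
  0 < (-1) ^ i * rprod (fun j => t (skip i j) - t i) m.
Proof.
  intros Hi Ht.
  assert (Hlt := increasing_lt t (S m) Ht).
  assert (A : forall r, (r <= m)%nat ->
    0 < (-1) ^ (Nat.min r i) * rprod (fun j => t (skip i j) - t i) r).
  { induction r as [|r IH]; intros Hr; [simpl; lra|].
    specialize (IH ltac:(lia)). simpl rprod. unfold skip at 2.
    destruct (Nat.ltb_spec r i).
    - replace (Nat.min (S r) i) with (S r) by lia.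
      replace (Nat.min r i) with r in IH by lia.
      assert (t r < t i) by (apply Hlt; lia).
      rewrite <- tech_pow_Rmult. nra.
    - replace (Nat.min (S r) i) with i by lia.
      replace (Nat.min r i) with i in IH by lia.
      assert (t i < t (S r)) by (apply Hlt; lia). nra. }
  specialize (A m (le_n _)). now replace (Nat.min m i) with i in A by lia.
Qed.

(** Since [exp (t * x) * f x] has derivative [exp (t * x) * (t * f x + f' x)], the mean value
    theorem between two consecutive points gives the sign of [f] at the later one. *)
Lemma alternation_step (f f' : R -> R) (t s : R) N (x : nat -> R) :
  (forall x, is_derive f x (f' x)) ->
  (forall j, (j <= N)%nat -> x j < x (S j)) ->
  (forall j, (j <= S N)%nat -> 0 <= s * (-1) ^ (S N - j) * f (x j)) ->
  exists y, (forall j, (j <= N)%nat -> x j < y j < x (S j)) /\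
    forall j, (j <= N)%nat -> 0 <= s * (-1) ^ (N - j) * (t * f (y j) + f' (y j)).
Proof.
  intros Hf Hx Hs.
  destruct (finite_choice (fun j y => x j < y < x (S j) /\
    0 <= s * (-1) ^ (N - j) * (t * f y + f' y)) 0 (S N)) as [y Hy].
  - intros j Hj.
    destruct (MVT_is_derive (fun x => exp (t * x) * f x)
      (fun x => exp (t * x) * (t * f x + f' x)) (x j) (x (S j)))
      as [c [E Hc]]; [apply Hx; lia| |].
    { intros u _.
      replace (exp (t * u) * (t * f u + f' u))
        with ((t * exp (t * u)) * f u + exp (t * u) * f' u) by ring.
      apply (is_derive_mult (fun u => exp (t * u)) f); [|apply Hf|intros; apply Rmult_comm].
      auto_derive; [auto|ring]. }
    exists c; split; [exact Hc|].
    assert (A := Hs (S j) ltac:(lia)). assert (B := Hs j ltac:(lia)).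
    replace (S N - S j)%nat with (N - j)%nat in A by lia.
    replace (S N - j)%nat with (S (N - j)) in B by lia.
    rewrite <- tech_pow_Rmult in B.
    assert (P1 := exp_pos (t * x (S j))). assert (P2 := exp_pos (t * x j)).
    assert (P3 := exp_pos (t * c)).
    set (q := s * (-1) ^ (N - j)) in *.
    assert (A' := Rmult_le_pos _ _ (Rlt_le _ _ P1) A).
    assert (B' := Rmult_le_pos _ _ (Rlt_le _ _ P2) B).
    apply (Rmult_le_reg_l (exp (t * c) * (x (S j) - x j))).
    { apply Rmult_lt_0_compat; lra. }
    replace (exp (t * c) * (x (S j) - x j) * (q * (t * f c + f' c)))
      with (q * (exp (t * c) * (t * f c + f' c) * (x (S j) - x j))) by ring.
    rewrite <- E. unfold q in *. lra.
  - exists y; split; intros j Hj; apply Hy; lia.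
Qed.

(* [dshift t N g] is the jet of [prod_(i < N) (D + t i)] applied to the function
   [g 0], where [g] is given together with all its derivatives [g k]. *)
Fixpoint dshift (t : nat -> R) (N : nat) (g : nat -> R -> R) : nat -> R -> R :=
  match N with
  | O => g
  | S m => dshift t m (fun k x => t m * g k x + g (S k) x)
  end.

Definition is_jet (g : nat -> R -> R) : Prop :=
  forall k x, is_derive (g k) x (g (S k) x).

(* Each [D + t i] kills one exponential, and by Rolle's theorem shortens an
   alternation by one point while preserving the sign at its last point. *)
Lemma alternation_dshift (t : nat -> R) N : forall g b s x,
  is_jet g -> 0 < x O -> (forall j, (j < N)%nat -> x j < x (S j)) ->
  (forall j, (j <= N)%nat -> 0 <= s * (-1) ^ (N - j) *
     (g O (x j) + rsum (fun i => b i * exp (- t i * x j)) N)) ->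
  exists y, 0 < y /\ 0 <= s * dshift t N g O y.
Proof.
  induction N as [|N IH]; intros g b s x Hg H0 Hx Hs.
  - exists (x O); split; [exact H0|]. specialize (Hs O (le_n _)); simpl in *.
    now replace (s * g O (x O)) with (s * 1 * (g O (x O) + 0)) by ring.
  - destruct (alternation_step
      (fun x => g O x + rsum (fun i => b i * exp (- t i * x)) (S N))
      (fun x => g 1%nat x + rsum (fun i => b i * (- t i * exp (- t i * x))) (S N))
      (t N) s N x) as [y [Hy Hsy]].
    + intros u. apply (is_derive_plus (V := R_NormedModule)); [apply Hg|].
      apply (is_derive_rsum (fun i x => b i * exp (- t i * x))
        (fun i x => b i * (- t i * exp (- t i * x)))).
      intros i _. apply is_derive_scal. auto_derive; [auto|ring].
    + intros j Hj; apply Hx; lia.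
    + exact Hs.
    + apply (IH _ (fun i => b i * (t N - t i)) s y).
      * intros k u. apply (is_derive_plus (V := R_NormedModule)); [|apply Hg].
        apply is_derive_scal, Hg.
      * specialize (Hy O ltac:(lia)); lra.
      * intros j Hj. assert (A := Hy j ltac:(lia)).
        assert (B := Hy (S j) ltac:(lia)). lra.
      * intros j Hj. specialize (Hsy j Hj).
        eapply Rle_trans; [exact Hsy|right]. f_equal.
        simpl rsum.
        replace (rsum (fun i => b i * (t N - t i) * exp (- t i * y j)) N)
          with (t N * rsum (fun i => b i * exp (- t i * y j)) N +
                rsum (fun i => b i * (- t i * exp (- t i * y j))) N).
        2:{ rewrite <- rsum_scal, <- rsum_plus. apply rsum_ext; intros; ring. }
        ring.
Qed.

Lemma dshift_ext t N : forall g h k x,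
  (forall k x, g k x = h k x) -> dshift t N g k x = dshift t N h k x.
Proof.
  induction N as [|N IH]; intros g h k x H; simpl; [apply H|].
  apply IH; intros; now rewrite !H.
Qed.

Lemma dshift_linear t N : forall g h a b k x,
  dshift t N (fun k x => a * g k x + b * h k x) k x
  = a * dshift t N g k x + b * dshift t N h k x.
Proof.
  induction N as [|N IH]; intros g h a b k x; simpl; [reflexivity|].
  rewrite <- IH. apply dshift_ext; intros; ring.
Qed.

Definition exp_jet (tau : R) (k : nat) (x : R) : R := (- tau) ^ k * exp (- tau * x).

Lemma exp_jet_is_jet tau : is_jet (exp_jet tau).
Proof. intros k x; unfold exp_jet; auto_derive; [auto|simpl; ring]. Qed.

Lemma dshift_exp_jet t tau N : forall k x,
  dshift t N (exp_jet tau) k x = rprod (fun i => t i - tau) N * exp_jet tau k x.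
Proof.
  induction N as [|N IH]; intros k x; simpl; [ring|].
  transitivity (dshift t N (fun k x => (t N - tau) * exp_jet tau k x
                                     + 0 * exp_jet tau k x) k x).
  - apply dshift_ext; intros; unfold exp_jet; simpl; ring.
  - rewrite dshift_linear, IH; ring.
Qed.

(** Only [t 0] may vanish, and its factor is applied last, when positivity of the first derivative
    suffices. Before that, [t i > 0] keeps [t i * g 1 + g 2] positive even if [g 2] vanishes, as it
    does for the first power. *)
Lemma dshift_pos t N : forall g,
  (forall k x, 0 < x -> 0 <= g k x) ->
  (forall x, 0 < x -> 0 < g O x) -> (forall x, 0 < x -> 0 < g 1%nat x) ->
  (forall i, (i < N)%nat -> 0 <= t i) ->
  (forall i, (0 < i < N)%nat -> 0 < t i) ->
  forall x, 0 < x -> 0 < dshift t N g O x.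
Proof.
  induction N as [|N IH]; intros g Hg H0 H1 Ht Ht' x Hx; simpl; [auto|].
  assert (tN := Ht N ltac:(lia)).
  assert (P0 : forall x, 0 < x -> 0 < t N * g O x + g 1%nat x).
  { intros y Hy. assert (0 <= t N * g O y) by (apply Rmult_le_pos; auto).
    specialize (H1 y Hy). lra. }
  destruct N as [|N]; [simpl; auto|].
  apply IH; auto.
  - intros k y Hy. assert (0 <= t (S N) * g k y) by (apply Rmult_le_pos; auto).
    specialize (Hg (S k) y Hy). lra.
  - intros y Hy.
    assert (0 < t (S N) * g 1%nat y) by (apply Rmult_lt_0_compat; [apply Ht'; lia|auto]).
    specialize (Hg 2%nat y Hy). lra.
  - intros i Hi; apply Ht'; lia.
Qed.

Fixpoint pow_jet (l k : nat) (x : R) {struct k} : R :=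
  match k with
  | O => x ^ l
  | S k' => match l with O => 0 | S l' => INR l * pow_jet l' k' x end
  end.

Lemma pow_jet_is_jet l : is_jet (pow_jet l).
Proof.
  intros k; revert l; induction k as [|k IH]; intros [|l] x.
  - apply (is_derive_ext (fun _ => 1)); [reflexivity|]. apply (is_derive_const 1).
  - change (pow_jet (S l) 1 x) with (INR (S l) * x ^ l).
    change (is_derive (fun x => x ^ S l) x (INR (S l) * x ^ l)).
    auto_derive; [auto|]. rewrite S_INR. destruct l; simpl; ring.
  - apply (is_derive_const 0).
  - cbn [pow_jet]. apply is_derive_scal, IH.
Qed.

Lemma pow_jet_ge0 l k x : 0 < x -> 0 <= pow_jet l k x.
Proof.
  intros Hx; revert l; induction k as [|k IH]; intros l; cbn [pow_jet].
  - apply pow_le; lra.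
  - destruct l as [|l]; [lra|]. apply Rmult_le_pos; [apply pos_INR|apply IH].
Qed.

Lemma dshift_pow_jet_pos l t N x :
  (1 <= l)%nat -> (forall i, (i < N)%nat -> 0 <= t i) ->
  (forall i, (0 < i < N)%nat -> 0 < t i) -> 0 < x ->
  0 < dshift t N (pow_jet l) O x.
Proof.
  intros Hl Ht Ht' Hx. apply dshift_pos; auto.
  - intros; now apply pow_jet_ge0.
  - intros y Hy; now apply pow_lt.
  - intros y Hy. destruct l as [|l]; [lia|]. cbn [pow_jet].
    apply Rmult_lt_0_compat; [apply lt_0_INR; lia|now apply pow_lt].
Qed.

(** As in Newton's form of interpolation, the new function is corrected by earlier ones so as to
    vanish at the earlier points. By hypothesis it then cannot vanish at the new point, and a
    multiple of it adjusts the value there alone. *)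
Lemma newton_interpolation (f : nat -> R -> R) (x : nat -> R) n :
  (forall m w, (m < n)%nat ->
     ~ (forall j, (j <= m)%nat -> f m (x j) + rsum (fun i => w i * f i (x j)) m = 0)) ->
  forall y, exists c, forall j, (j < n)%nat -> rsum (fun i => c i * f i (x j)) n = y j.
Proof.
  induction n as [|m IH]; intros Hn y; [exists (fun _ => 0); intros; lia|].
  assert (IH' : forall y, exists c,
    forall j, (j < m)%nat -> rsum (fun i => c i * f i (x j)) m = y j).
  { apply IH; intros k w Hk; apply Hn; lia. }
  destruct (IH' y) as [c0 Hc0]. destruct (IH' (fun j => - f m (x j))) as [w Hw].
  set (W := f m (x m) + rsum (fun i => w i * f i (x m)) m).
  assert (HW : W <> 0).
  { intros E. apply (Hn m w ltac:(lia)). intros j Hj.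
    destruct (Nat.eq_dec j m) as [->|]; [exact E|]. rewrite Hw by lia. ring. }
  set (mu := (y m - rsum (fun i => c0 i * f i (x m)) m) / W).
  exists (fun i => if Nat.eq_dec i m then mu else c0 i + mu * w i).
  intros j Hj. simpl rsum. destruct (Nat.eq_dec m m) as [_|]; [|lia].
  rewrite (rsum_ext _ (fun i => c0 i * f i (x j) + mu * (w i * f i (x j)))).
  2:{ intros i Hi. destruct (Nat.eq_dec i m); [lia|ring]. }
  rewrite rsum_plus, rsum_scal.
  destruct (Nat.eq_dec j m) as [->|].
  - unfold mu. unfold W in *. field. exact HW.
  - rewrite Hc0, Hw by lia. ring.
Qed.

(** * Differentiation formulas exact on exponentials *)

(* For [p] in the span of the [exp (- H j * t)],
   [p^(l) (0) = (-1)^l * sum_i c i * p (t i)]. *)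
Definition weights (l : nat) (t : nat -> R) (n : nat) (H c : nat -> R) : Prop :=
  forall j, (j < n)%nat -> H j ^ l = rsum (fun i => c i * exp (- t i * H j)) n.

Definition nodes (n : nat) (t : nat -> R) : Prop :=
  t O = 0 /\ forall j, (S j < n)%nat -> t j < t (S j).

Definition exponents (n : nat) (H : nat -> R) : Prop :=
  0 < H O /\ forall j, (S j < n)%nat -> H j < H (S j).

Lemma nodes_pos n t i : nodes n t -> (0 < i < n)%nat -> 0 < t i.
Proof. intros [H0 Ht] Hi. rewrite <- H0. now apply (increasing_lt t n). Qed.

Lemma nodes_ge0 n t i : nodes n t -> (i < n)%nat -> 0 <= t i.
Proof.
  intros Ht Hi. destruct i as [|i]; [destruct Ht; lra|].
  apply Rlt_le, (nodes_pos n); [auto|lia].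
Qed.

(** Were a combination of exponentials with leading term [exp (- t m * x)] to vanish at [m + 1]
    points, these zeros would alternate for every [s]. Applying [D + t i] for [i < m] leaves a
    nonzero multiple of [exp (- t m * y)], whose sign excludes one choice of [s]. *)
Lemma weights_exist l t n H :
  nodes n t -> exponents n H -> exists c, weights l t n H c.
Proof.
  intros [_ Ht] [H0 HH].
  destruct (newton_interpolation (fun i x => exp (- t i * x)) H n) with
    (y := fun j => H j ^ l) as [c Hc].
  - intros m w Hm Hz.
    assert (A : forall s, exists y, 0 < y /\
      0 <= s * (rprod (fun i => t i - t m) m * exp (- t m * y))).
    { intros s.
      destruct (alternation_dshift t m (exp_jet (t m)) w s H) as [y [Hy E]].
      - apply exp_jet_is_jet.
      - exact H0.
      - intros j Hj; apply HH; lia.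
      - intros j Hj. unfold exp_jet. rewrite pow_O, Rmult_1_l, Hz by exact Hj. lra.
      - exists y; split; [exact Hy|]. rewrite dshift_exp_jet in E.
        unfold exp_jet in E. rewrite pow_O, Rmult_1_l in E. exact E. }
    assert (NZ : rprod (fun i => t i - t m) m <> 0).
    { apply rprod_neq0; intros i Hi.
      assert (t i < t m) by (apply (increasing_lt t n); [exact Ht|lia]). lra. }
    destruct (A (- rprod (fun i => t i - t m) m)) as [y [_ E]].
    assert (P := exp_pos (- t m * y)).
    assert (0 < rprod (fun i => t i - t m) m * rprod (fun i => t i - t m) m) by nra.
    nra.
  - exists c. intros j Hj. now rewrite Hc.
Qed.

Lemma skip_lt i j m : (i <= m)%nat -> (j < m)%nat -> (skip i j < S m)%nat.
Proof. unfold skip; destruct (Nat.ltb_spec j i); lia. Qed.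

Lemma skip_pos i j : (0 < j)%nat -> (0 < skip i j)%nat.
Proof. unfold skip; destruct (Nat.ltb_spec j i); lia. Qed.

Lemma dshift_skip_pos l t m i x :
  (1 <= l)%nat -> nodes (S m) t -> (i <= m)%nat -> 0 < x ->
  0 < dshift (fun j => t (skip i j)) m (pow_jet l) O x.
Proof.
  intros Hl Ht Hi Hx. apply dshift_pow_jet_pos; auto.
  - intros j Hj; apply (nodes_ge0 (S m)); [auto|now apply skip_lt].
  - intros j Hj; apply (nodes_pos (S m)); [auto|].
    split; [apply skip_pos; lia|apply skip_lt; lia].
Qed.

(** All exponentials but the [i]-th are eliminated from the remainder
    [x^l - sum_i c i * exp (- t i * x)], which vanishes at the exponents. The image of [x^l] stays
    positive, so [c i] times the product of the [t j - t i] is positive, and that product has sign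
    [(-1)^i]. *)
Lemma weights_sign l t n H c i :
  (1 <= l)%nat -> nodes n t -> exponents n H -> weights l t n H c ->
  (i < n)%nat -> 0 < (-1) ^ i * c i.
Proof.
  intros Hl Ht [H0 HH] Hc Hi. destruct n as [|m]; [lia|].
  set (g := fun k x => 1 * pow_jet l k x + - c i * exp_jet (t i) k x).
  set (t' := fun j => t (skip i j)).
  assert (A : forall s, exists y, 0 < y /\ 0 <= s *
     (dshift t' m (pow_jet l) O y
       - c i * (rprod (fun j => t' j - t i) m * exp (- t i * y)))).
  { intros s.
    destruct (alternation_dshift t' m g (fun j => - c (skip i j)) s H)
      as [y [Hy E]].
    - intros k x. unfold g. apply (is_derive_plus (V := R_NormedModule));
        apply is_derive_scal; [apply pow_jet_is_jet|apply exp_jet_is_jet].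
    - exact H0.
    - intros j Hj; apply HH; lia.
    - intros j Hj. unfold g, exp_jet. cbn [pow_jet]. rewrite (Hc j) by lia.
      rewrite (rsum_skip _ m i) by lia.
      rewrite (rsum_ext (fun i0 => - c (skip i i0) * exp (- t' i0 * H j))
        (fun i0 => -1 * (c (skip i i0) * exp (- t (skip i i0) * H j)))).
      2:{ intros; unfold t'; ring. }
      rewrite rsum_scal. right. rewrite pow_O. ring.
    - exists y; split; [exact Hy|]. unfold g in E.
      rewrite dshift_linear, dshift_exp_jet in E. unfold exp_jet in E.
      rewrite pow_O in E.
      eapply Rle_trans; [exact E|right; ring]. }
  destruct (A (-1)) as [y [Hy E]].
  assert (P := dshift_skip_pos l t m i y Hl Ht ltac:(lia) Hy).
  fold t' in P.
  assert (Q := rprod_skip_sign t m i ltac:(lia) (proj2 Ht)).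
  fold (t') in Q. change (fun j => t (skip i j) - t i) with (fun j => t' j - t i) in Q.
  assert (X := exp_pos (- t i * y)).
  set (p := rprod (fun j => t' j - t i) m) in *.
  assert (R1 : 0 < c i * p) by nra.
  apply (Rmult_lt_reg_r ((-1) ^ i * p)); [exact Q|].
  replace ((-1) ^ i * c i * ((-1) ^ i * p)) with ((-1) ^ i * (-1) ^ i * (c i * p)) by ring.
  rewrite sign_sqr; lra.
Qed.

(** * Monotonicity of the weights in the exponents *)

Definition insert_at (k : nat) (x : R) (h : nat -> R) (j : nat) : R :=
  if (j <? k)%nat then h j else if (j =? k)%nat then x else h (pred j).

Lemma insert_at_increasing k x h n :
  (forall j, (S j < n)%nat -> h j < h (S j)) ->
  (forall j, (j < n)%nat -> (j < k)%nat -> h j < x) ->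
  (forall j, (j < n)%nat -> (k <= j)%nat -> x < h j) -> (k <= n)%nat ->
  forall j, (S j < S n)%nat -> insert_at k x h j < insert_at k x h (S j).
Proof.
  intros Hh H1 H2 Hk j Hj. unfold insert_at.
  destruct (Nat.ltb_spec j k), (Nat.ltb_spec (S j) k), (Nat.eqb_spec j k),
    (Nat.eqb_spec (S j) k); subst; simpl; try lia;
    first [apply Hh; lia | apply H1; lia | apply H2; lia | idtac].
  destruct j as [|j]; [lia|]. apply Hh; lia.
Qed.

(** The sign of the old remainder [G] at the moved exponent [H' k] is known from its position among
    the zeros of [G]. It contradicts the sign pattern that a decrease of [|c i|] would impose. *)
Lemma weights_monotone_step l t n H H' k c c' i :
  (1 <= l)%nat -> nodes n t -> exponents n H -> exponents n H' ->
  (k < n)%nat -> H k < H' k -> (forall j, (j < n)%nat -> j <> k -> H j = H' j) ->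
  weights l t n H c -> weights l t n H' c' ->
  (i < n)%nat -> Rabs (c i) <= Rabs (c' i).
Proof.
  intros Hl Ht HH HH' Hk Hkk Heq Hc Hc' Hi.
  assert (S1 := weights_sign l t n H c i Hl Ht HH Hc Hi).
  assert (S2 := weights_sign l t n H' c' i Hl Ht HH' Hc' Hi).
  destruct n as [|m]; [lia|].
  set (G := fun x => x ^ l - rsum (fun i => c i * exp (- t i * x)) (S m)).
  (* The wrong sign at [H' k] would join the zeros [H j] in an alternation at [m + 2] points.
     Eliminating all [m + 1] exponentials would then make the image of [x^l] nonpositive
     somewhere. *)
  assert (HG : 0 <= (-1) ^ (m - k) * G (H' k)).
  { apply Rnot_lt_le; intros Hneg.
    destruct (alternation_dshift t (S m) (pow_jet l) (fun i => - c i) (-1)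
      (insert_at (S k) (H' k) H)) as [y [Hy E]].
    - apply pow_jet_is_jet.
    - unfold insert_at; simpl; apply HH.
    - intros j Hj. apply (insert_at_increasing _ _ _ (S m)); try lia.
      + apply HH.
      + intros j' Hj' Hle. destruct (Nat.eq_dec j' k) as [->|]; [exact Hkk|].
        rewrite Heq by lia. apply (increasing_lt H' (S m)); [apply HH'|lia].
      + intros j' Hj' Hle. rewrite Heq by lia.
        apply (increasing_lt H' (S m)); [apply HH'|lia].
    - intros j Hj.
      set (z := insert_at (S k) (H' k) H j).
      replace (pow_jet l O z + rsum (fun i => - c i * exp (- t i * z)) (S m))
        with (G z).
      2:{ unfold G. cbn [pow_jet].
          rewrite (rsum_ext (fun i => - c i * exp (- t i * z))
            (fun i => -1 * (c i * exp (- t i * z)))) by (intros; ring).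
          rewrite rsum_scal; ring. }
      assert (G0 : forall j, (j < S m)%nat -> G (H j) = 0).
      { intros j' Hj'. unfold G. rewrite <- Hc by exact Hj'. ring. }
      unfold z, insert_at.
      destruct (Nat.ltb_spec j (S k)); [rewrite G0 by lia; lra|].
      destruct (Nat.eqb_spec j (S k)) as [->|]; [|rewrite G0 by lia; lra].
      simpl Nat.sub. lra.
    - assert (P := dshift_pow_jet_pos l t (S m) y Hl
        (fun i => nodes_ge0 (S m) t i Ht) (fun i => nodes_pos (S m) t i Ht) Hy).
      lra. }
  assert (main : (-1) ^ i * c i <= (-1) ^ i * c' i).
  { apply Rnot_lt_le; intros Hlt.
    assert (NZ : c' i <> 0) by (intros E; rewrite E in S2; lra).
    (* The old remainder minus [th] times the new one has no [i]-th exponential and carries [x^l]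
       with the factor [1 - th < 0]. At the points [H' j] the new remainder vanishes, so the values
       there are those of [G]: zero except at [H' k]. *)
    set (th := c i / c' i).
    assert (Hth : c i = th * c' i) by (unfold th; field; exact NZ).
    assert (th1 : 1 < th).
    { apply (Rmult_lt_reg_r ((-1) ^ i * c' i)); [exact S2|].
      rewrite Hth in Hlt. lra. }
    set (t' := fun j => t (skip i j)).
    destruct (alternation_dshift t' m
      (fun k x => (1 - th) * pow_jet l k x + 0 * pow_jet l k x)
      (fun j => - (c (skip i j) - th * c' (skip i j))) 1 H') as [y [Hy E]].
    - intros k' x. apply (is_derive_plus (V := R_NormedModule));
        apply is_derive_scal, pow_jet_is_jet.
    - apply HH'.
    - intros j Hj; apply HH'; lia.
    - intros j Hj. cbn [pow_jet].
      assert (E : (1 - th) * H' j ^ l + 0 * H' j ^ l +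
        rsum (fun i0 => - (c (skip i i0) - th * c' (skip i i0)) * exp (- t' i0 * H' j)) m
        = G (H' j)).
      { unfold G.
        replace ((1 - th) * H' j ^ l + 0 * H' j ^ l) with (H' j ^ l - th * H' j ^ l) by ring.
        rewrite (Hc' j) at 2 by lia. rewrite !(rsum_skip _ m i) by lia.
        rewrite (rsum_ext (fun i0 => - (c (skip i i0) - th * c' (skip i i0)) * exp (- t' i0 * H' j))
          (fun i0 => th * (c' (skip i i0) * exp (- t (skip i i0) * H' j))
                     - c (skip i i0) * exp (- t (skip i i0) * H' j))).
        2:{ intros; unfold t'; ring. }
        rewrite rsum_minus, rsum_scal, Hth. ring. }
      rewrite E. destruct (Nat.eq_dec j k) as [->|]; [lra|].
      rewrite <- Heq by lia. unfold G. rewrite <- Hc by lia. right; ring.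
    - rewrite dshift_linear in E.
      assert (P := dshift_skip_pos l t m i y Hl Ht ltac:(lia) Hy).
      fold t' in P. nra. }
  replace (Rabs (c i)) with ((-1) ^ i * c i).
  2:{ rewrite <- (Rabs_pos_eq ((-1) ^ i * c i)) by lra.
      rewrite Rabs_mult, Rabs_sign; ring. }
  replace (Rabs (c' i)) with ((-1) ^ i * c' i); [exact main|].
  rewrite <- (Rabs_pos_eq ((-1) ^ i * c' i)) by lra.
  rewrite Rabs_mult, Rabs_sign; ring.
Qed.

Lemma weights_monotone l t n H E c :
  (1 <= l)%nat -> nodes n t -> exponents n H -> exponents n E ->
  (forall j, (j < n)%nat -> H j < E j) -> weights l t n H c ->
  exists c', weights l t n E c' /\
    forall i, (i < n)%nat -> Rabs (c i) <= Rabs (c' i).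
Proof.
  intros Hl Ht HH HE Hlt Hc.
  (* The exponents are raised one at a time from the largest down, so every intermediate family
     remains increasing. *)
  set (hyb := fun r j => if (j <? n - r)%nat then H j else E j).
  assert (Hhyb : forall r, exponents n (hyb r)).
  { intros r; split.
    - unfold hyb. destruct (Nat.ltb_spec 0 (n - r)); [apply HH|apply HE].
    - intros j Hj; unfold hyb.
      destruct (Nat.ltb_spec j (n - r)), (Nat.ltb_spec (S j) (n - r)); try lia.
      + apply HH; lia.
      + apply Rlt_trans with (H (S j)); [apply HH; lia|apply Hlt; lia].
      + apply HE; lia. }
  assert (A : forall r, (r <= n)%nat -> exists c', weights l t n (hyb r) c' /\
    forall i, (i < n)%nat -> Rabs (c i) <= Rabs (c' i)).
  { induction r as [|r IH]; intros Hr.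
    - exists c; split; [|intros; lra]. intros j Hj. unfold hyb.
      destruct (Nat.ltb_spec j (n - 0)); [now apply Hc|lia].
    - destruct IH as [c1 [W1 L1]]; [lia|].
      destruct (weights_exist l t n (hyb (S r)) Ht (Hhyb _)) as [c2 W2].
      exists c2; split; [exact W2|]. intros i Hi.
      apply Rle_trans with (Rabs (c1 i)); [auto|].
      apply (weights_monotone_step l t n (hyb r) (hyb (S r)) (n - S r) c1 c2);
        auto; try lia.
      + unfold hyb. destruct (Nat.ltb_spec (n - S r) (n - r)); [|lia].
        destruct (Nat.ltb_spec (n - S r) (n - S r)); [lia|]. apply Hlt; lia.
      + intros j Hj Hne. unfold hyb.
        destruct (Nat.ltb_spec j (n - r)), (Nat.ltb_spec j (n - S r)); auto; lia. }
  destruct (A n (le_n _)) as [c' [W L]]. exists c'; split; [|exact L].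
  intros j Hj. specialize (W j Hj). unfold hyb in W.
  destruct (Nat.ltb_spec j (n - n)); [lia|exact W].
Qed.

(** * The comparison principle *)

Lemma insertion_index (H : nat -> R) n x :
  (forall j, (S j < n)%nat -> H j < H (S j)) ->
  (forall j, (j < n)%nat -> H j <> x) ->
  exists k, (k <= n)%nat /\ (forall j, (j < k)%nat -> H j < x) /\
    (forall j, (k <= j < n)%nat -> x < H j).
Proof.
  intros HH Hx; induction n as [|n IH].
  - exists O; repeat split; intros; lia.
  - destruct IH as [k [Hk [H1 H2]]]; [intros; apply HH; lia|intros; apply Hx; lia|].
    destruct (Rtotal_order (H n) x) as [Hlt|[Heq|Hgt]].
    + exists (S n); repeat split; [lia| |intros; lia].
      intros j Hj. destruct (Nat.eq_dec j n) as [->|]; [exact Hlt|].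
      apply Rlt_trans with (H n); [|exact Hlt].
      apply (increasing_lt H (S n)); [exact HH|lia].
    + exfalso; apply (Hx n); [lia|exact Heq].
    + exists k; repeat split; [lia|exact H1|].
      intros j Hj. destruct (Nat.eq_dec j n) as [->|]; [exact Hgt|apply H2; lia].
Qed.

(** The shifted exponents coming from different [h i] may coincide. Free places are filled by new
    points between the largest exponent and 1, so the family always has [n] distinct members. *)
Lemma increasing_enclosure (v : nat -> R) n :
  (forall i, (i < n)%nat -> 0 < v i < 1) ->
  exists H, exponents n H /\ (forall j, (j < n)%nat -> 0 < H j < 1) /\
    forall i, (i < n)%nat -> exists j, (j < n)%nat /\ H j = v i.
Proof.
  induction n as [|n IH]; intros Hv.
  - exists (fun _ => / 2); repeat split; intros; try lia; lra.
  - destruct IH as [H [[H0 HH] [Hb Hr]]]; [auto|].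
    assert (Ins : forall k x, (k <= n)%nat -> 0 < x < 1 ->
      (forall j, (j < k)%nat -> H j < x) ->
      (forall j, (k <= j < n)%nat -> x < H j) ->
      let H' := insert_at k x H in
      exponents (S n) H' /\ (forall j, (j < S n)%nat -> 0 < H' j < 1) /\
      H' k = x /\ forall j, (j < n)%nat -> exists j', (j' < S n)%nat /\ H' j' = H j).
    { intros k x Hk Hx H1 H2 H'. unfold H'.
      assert (B : forall j, (j < S n)%nat -> 0 < insert_at k x H j < 1).
      { intros j Hj. unfold insert_at.
        destruct (Nat.ltb_spec j k); [apply Hb; lia|].
        destruct (Nat.eqb_spec j k); [exact Hx|]. apply Hb; lia. }
      repeat split; try (apply B; lia).
      - apply insert_at_increasing; auto.
      - unfold insert_at. destruct (Nat.ltb_spec k k); [lia|].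
        now rewrite Nat.eqb_refl.
      - intros j Hj. destruct (Nat.lt_ge_cases j k).
        + exists j; split; [lia|]. unfold insert_at.
          destruct (Nat.ltb_spec j k); [reflexivity|lia].
        + exists (S j); split; [lia|]. unfold insert_at.
          destruct (Nat.ltb_spec (S j) k); [lia|].
          destruct (Nat.eqb_spec (S j) k); [lia|reflexivity]. }
    assert (Hvn := Hv n ltac:(lia)).
    destruct (classic (exists j, (j < n)%nat /\ H j = v n)) as [[j0 [Hj0 E0]]|Hno].
    + assert (Hl : forall j, (j < n)%nat -> H j <= H (pred n)).
      { intros j Hj. destruct (Nat.eq_dec j (pred n)) as [->|]; [lra|].
        apply Rlt_le, (increasing_lt H n); [exact HH|lia]. }
      assert (Hb' := Hb (pred n) ltac:(lia)).
      destruct (Ins n ((H (pred n) + 1) / 2)) as [P1 [P2 [_ P4]]]; try lia; try lra.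
      { intros j Hj. specialize (Hl j Hj). lra. }
      exists (insert_at n ((H (pred n) + 1) / 2) H); repeat split; try apply P1; try (apply P2; lia).
      intros i Hi. destruct (Nat.eq_dec i n) as [->|].
      * rewrite <- E0. now apply P4.
      * destruct (Hr i ltac:(lia)) as [j [Hj E]]. rewrite <- E. now apply P4.
    + destruct (insertion_index H n (v n) HH) as [k [Hk [K1 K2]]].
      { intros j Hj E; apply Hno; eauto. }
      destruct (Ins k (v n) Hk Hvn K1 K2) as [P1 [P2 [P3 P4]]].
      exists (insert_at k (v n) H); repeat split; try apply P1; try (apply P2; lia).
      intros i Hi. destruct (Nat.eq_dec i n) as [->|].
      * exists k; split; [lia|exact P3].
      * destruct (Hr i ltac:(lia)) as [j [Hj E]]. rewrite <- E. now apply P4.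
Qed.

Lemma rsum_swap (f : nat -> nat -> R) m n :
  rsum (fun i => rsum (fun j => f i j) n) m = rsum (fun j => rsum (fun i => f i j) m) n.
Proof.
  induction m as [|m IH]; simpl.
  - symmetry; apply rsum_0; auto.
  - now rewrite IH, rsum_plus.
Qed.

(* A differentiation formula exact at the exponents [h - (j + 1) * eps], [j <= k],
   is exact on [t ^ k * exp (- xi * t)] for some [xi] close to [h]; this replaces
   a confluence argument for multiple exponents. *)
Lemma weights_multiple l t n H c h k eps s :
  0 < eps -> weights l t n H c ->
  (forall j, (j <= k)%nat -> exists i, (i < n)%nat /\ H i = h - INR (S j) * eps) ->
  exists xi, h - INR (S k) * eps <= xi <= h /\
    dexp k l xi s = (-1) ^ l * rsum (fun i => c i * dexp k 0 xi (t i + s)) n.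
Proof.
  intros He Hc Hh.
  set (F := fun k x => dexp k l x s
     - (-1) ^ l * rsum (fun i => c i * dexp k 0 x (t i + s)) n).
  destruct (iterated_rolle k F (fun j => h - INR (S (k - j)) * eps)) as [xi [Hxi E]].
  - intros j x. unfold F. apply (is_derive_minus (V := R_NormedModule)).
    + apply is_derive_dexp_lam.
    + apply is_derive_scal.
      apply (is_derive_rsum (fun i x => c i * dexp j 0 x (t i + s))
        (fun i x => c i * dexp (S j) 0 x (t i + s))).
      intros i _. apply is_derive_scal. apply (is_derive_dexp_lam 0).
  - intros j Hj. replace (k - j)%nat with (S (k - S j)) by lia.
    rewrite (S_INR (S _)). lra.
  - intros j Hj. destruct (Hh (k - j)%nat) as [i [Hi Ei]]; [lia|].
    rewrite <- Ei. unfold F. rewrite dexp_0_l.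
    replace (- H i) with (-1 * H i) at 1 by ring.
    rewrite Rpow_mult_distr, (Hc i Hi), Rmult_assoc.
    rewrite (Rmult_comm (rsum _ _)), <- rsum_scal.
    rewrite (rsum_ext (fun i0 => exp (- H i * s) * (c i0 * exp (- t i0 * H i)))
      (fun i0 => c i0 * dexp 0 0 (H i) (t i0 + s))); [ring|].
    intros i0 _. simpl. rewrite Rmult_1_l.
    replace (- H i * (t i0 + s)) with (- t i0 * H i + - H i * s) by ring.
    rewrite exp_plus. ring.
  - exists xi; split.
    + rewrite Nat.sub_0_r, Nat.sub_diag in Hxi. replace (INR 1) with 1 in Hxi by reflexivity. lra.
    + unfold F in E. lra.
Qed.

(* The [l]-th derivative at [s] of [t |-> sum_i a i * t ^ k i * exp (- xi i * t)]. *)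
Definition quasi (a : nat -> R) (k : nat -> nat) (n l : nat) (xi : nat -> R) (s : R) : R :=
  rsum (fun i => a i * ((-1) ^ k i * dexp (k i) l (xi i) s)) n.

Lemma quasi_continuous a k n l h s eta :
  0 < eta -> exists rho, 0 < rho /\ forall xi,
    (forall i, (i < n)%nat -> Rabs (xi i - h i) < rho) ->
    Rabs (quasi a k n l xi s - quasi a k n l h s) < eta.
Proof.
  unfold quasi. revert eta; induction n as [|n IH]; intros eta He.
  - exists 1; split; [lra|]. intros; simpl. rewrite Rminus_diag, Rabs_R0; lra.
  - destruct (IH (eta / 2)) as [r [r0 Hr]]; [lra|].
    assert (C : continuity_pt (fun x => a n * ((-1) ^ k n * dexp (k n) l x s)) (h n)).
    { eapply is_derive_continuity. apply is_derive_scal, is_derive_scal, is_derive_dexp_lam. }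
    destruct (C (eta / 2)) as [r' [r0' Hr']]; [lra|].
    exists (Rmin r r'); split; [apply Rmin_glb_lt; auto|].
    intros xi Hxi. assert (M1 := Rmin_l r r'). assert (M2 := Rmin_r r r').
    assert (A : Rabs (a n * ((-1) ^ k n * dexp (k n) l (xi n) s)
      - a n * ((-1) ^ k n * dexp (k n) l (h n) s)) < eta / 2).
    { destruct (Req_dec (xi n) (h n)) as [->|Hne].
      - rewrite Rminus_diag, Rabs_R0; lra.
      - apply (Hr' (xi n)). split; [split; [exact I|auto]|].
        simpl. unfold Rdist. specialize (Hxi n ltac:(lia)). lra. }
    assert (B := Hr xi). simpl rsum.
    match goal with |- Rabs (?u + ?v - (?u' + ?v')) < _ =>
      replace (u + v - (u' + v')) with ((u - u') + (v - v')) by ring end.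
    eapply Rle_lt_trans; [apply Rabs_triang|].
    assert (B' := B ltac:(intros i Hi; specialize (Hxi i ltac:(lia)); lra)). lra.
Qed.

(** The tolerance [rho] is fixed before [H] and [c]: the formula is exact for the function with
    exponents [xi i], and [v] lists the values of that function at the nodes, so the size of the
    weights does not enter the error. *)
Lemma quasi_quadrature a k h n l t s eta :
  0 < eta -> (forall i, (i < n)%nat -> (k i < n)%nat) ->
  exists rho, 0 < rho /\ forall H c eps,
    0 < eps -> INR n * eps < rho -> weights l t n H c ->
    (forall i j, (i < n)%nat -> (j <= k i)%nat ->
       exists i', (i' < n)%nat /\ H i' = h i - INR (S j) * eps) ->
    exists v, (forall i, (i < n)%nat -> Rabs (v i - quasi a k n 0 h (t i + s)) < eta) /\
      Rabs (quasi a k n l h s - (-1) ^ l * rsum (fun i => c i * v i) n) < eta.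
Proof.
  intros He Hk.
  destruct (quasi_continuous a k n l h s eta He) as [r1 [r1p Hr1]].
  destruct (finite_pos_bound (fun m r => forall xi,
    (forall i, (i < n)%nat -> Rabs (xi i - h i) < r) ->
    Rabs (quasi a k n 0 xi (t m + s) - quasi a k n 0 h (t m + s)) < eta) n)
    as [r2 [r2p Hr2]].
  { intros m r r' Hm Hr xi Hxi. apply Hm. intros i Hi. specialize (Hxi i Hi). lra. }
  { intros m _. now apply quasi_continuous. }
  exists (Rmin r1 r2); split; [now apply Rmin_glb_lt|].
  intros H c eps Heps Hn Hc HH.
  assert (M1 := Rmin_l r1 r2). assert (M2 := Rmin_r r1 r2).
  destruct (finite_choice (fun i xi => Rabs (xi - h i) < Rmin r1 r2 /\
    dexp (k i) l xi s = (-1) ^ l * rsum (fun m => c m * dexp (k i) 0 xi (t m + s)) n)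
    0 n) as [xi Hxi].
  { intros i Hi.
    destruct (weights_multiple l t n H c (h i) (k i) eps s Heps Hc) as [xi [B E]].
    { intros j Hj. now apply HH. }
    exists xi; split; [|exact E].
    assert (INR (S (k i)) * eps <= INR n * eps).
    { apply Rmult_le_compat_r; [lra|]. apply le_INR. specialize (Hk i Hi). lia. }
    apply Rabs_def1; lra. }
  exists (fun m => quasi a k n 0 xi (t m + s)); split.
  - intros i Hi. apply Hr2; [exact Hi|]. intros j Hj. destruct (Hxi j Hj); lra.
  - replace ((-1) ^ l * rsum (fun i => c i * quasi a k n 0 xi (t i + s)) n)
      with (quasi a k n l xi s).
    + rewrite Rabs_minus_sym. apply Hr1. intros j Hj. destruct (Hxi j Hj); lra.
    + unfold quasi at 1.
      rewrite (rsum_ext _ (fun i => rsum (fun m => (-1) ^ l * (c m *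
        (a i * ((-1) ^ k i * dexp (k i) 0 (xi i) (t m + s))))) n)).
      2:{ intros i Hi. destruct (Hxi i Hi) as [_ ->].
          rewrite <- !rsum_scal. apply rsum_ext; intros; ring. }
      rewrite rsum_swap, <- rsum_scal. apply rsum_ext; intros m _.
      unfold quasi. rewrite <- !rsum_scal. apply rsum_ext; intros; ring.
Qed.

Lemma mult_le h x i : (Defs.mult h x i <= i)%nat.
Proof. induction i as [|i IH]; simpl; [lia|]. destruct (Req_EM_T (h i) x); lia. Qed.

Lemma mult_attained h x j i :
  (j < Defs.mult h x i)%nat -> exists i', (i' < i)%nat /\ h i' = x /\ Defs.mult h x i' = j.
Proof.
  induction i as [|i IH]; simpl; intros Hj; [lia|].
  destruct (Req_EM_T (h i) x) as [E|].
  - destruct (Nat.eq_dec j (Defs.mult h x i)) as [->|]; [exists i; auto|].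
    destruct IH as [i' [A B]]; [lia|]. exists i'; split; [lia|exact B].
  - destruct IH as [i' [A B]]; [lia|]. exists i'; split; [lia|exact B].
Qed.

Lemma comparison_quasi l n t sg q h a s :
  (1 <= n)%nat -> nodes n t -> Rabs sg = 1 ->
  (forall i, (i < n)%nat -> 1 <= sg * (-1) ^ i * quasi q (fun i => i) n 0 (fun _ => 1) (t i)) ->
  inI n h ->
  (forall u, 0 <= u -> Rabs (quasi a (fun i => Defs.mult h (h i) i) n 0 h u) <= 1) ->
  0 <= s ->
  Rabs (quasi a (fun i => Defs.mult h (h i) i) n l h s)
    <= Rabs (quasi q (fun i => i) n l (fun _ => 1) 0).
Proof.
  intros Hn Ht Hsg Hq Hh Ha Hs.
  set (k := fun i => Defs.mult h (h i) i) in *.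
  assert (sgs : sg = 1 \/ sg = -1).
  { revert Hsg; unfold Rabs; destruct (Rcase_abs sg); lra. }
  destruct l as [|l'].
  (* For [l = 0] the node [t 0 = 0] already gives [|Q (0)| >= 1]. *)
  { apply Rle_trans with 1; [auto|].
    specialize (Hq O Hn). rewrite (proj1 Ht) in Hq. simpl pow in Hq.
    eapply Rle_trans; [exact Hq|]. eapply Rle_trans; [apply Rle_abs|].
    rewrite !Rabs_mult, Hsg, Rabs_R1. lra. }
  set (l := S l') in *. assert (Hl : (1 <= l)%nat) by (unfold l; lia).
  set (A := Rabs (quasi a k n l h s)). set (K := Rabs (quasi q (fun i => i) n l (fun _ => 1) 0)).
  assert (A0 : 0 <= A) by apply Rabs_pos. assert (K0 : 0 <= K) by apply Rabs_pos.
  assert (main : forall eta, 0 < eta < 1 -> A * (1 - eta) <= eta * (1 - eta) + (1 + eta) * (K + eta)).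
  { intros eta He.
    destruct (quasi_quadrature a k h n l t s eta) as [r1 [r1p Q1]]; [lra| |].
    { intros i Hi. assert (B := mult_le h (h i) i). unfold k; lia. }
    destruct (quasi_quadrature q (fun i => i) (fun _ => 1) n l t 0 eta) as [r2 [r2p Q2]];
      [lra|auto|].
    assert (nn : 0 < INR n) by (apply lt_0_INR; lia).
    destruct (finite_pos_bound (fun i r => r <= h i) n) as [r3 [r3p Q3]].
    { intros; lra. }
    { intros i Hi; exists (h i). destruct (Hh i Hi); split; lra. }
    (* The largest shift, at most [INR n * eps = r4], stays within the tolerance [r1] and below
       every [h i], so the shifted exponents are positive. *)
    set (r4 := Rmin r1 r3 / 2).
    assert (r4p : 0 < r4 /\ r4 < r1 /\ r4 < r3).
    { unfold r4. assert (M1 := Rmin_l r1 r3). assert (M2 := Rmin_r r1 r3).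
      assert (0 < Rmin r1 r3) by now apply Rmin_glb_lt. lra. }
    set (eps := r4 / INR n).
    assert (epsp : 0 < eps) by (apply Rdiv_lt_0_compat; lra).
    assert (epsn : INR n * eps = r4) by (unfold eps; field; lra).
    assert (step : forall m, (m <= n)%nat -> INR m * eps <= r4).
    { intros m Hm. rewrite <- epsn. apply Rmult_le_compat_r; [lra|now apply le_INR]. }
    destruct (increasing_enclosure (fun i => h i - INR (S (k i)) * eps) n)
      as [H [HE [HB HR]]].
    { intros i Hi. destruct (Hh i Hi).
      assert (B := mult_le h (h i) i). fold (k i) in B.
      assert (S1 := step (S (k i)) ltac:(lia)). assert (S3 := Q3 i Hi).
      assert (0 < INR (S (k i)) * eps).
      { apply Rmult_lt_0_compat; [apply lt_0_INR; lia|exact epsp]. }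
      lra. }
    destruct (weights_exist l t n H Ht HE) as [c Hc].
    destruct (Q1 H c eps epsp) as [v [V1 V2]]; [lra|exact Hc| |].
    { intros i j Hi Hj. destruct (Nat.eq_dec j (k i)) as [->|Hne]; [now apply HR|].
      (* For [j < k i] the shift by [INR (S j) * eps] is the one attached to the earlier index of
         equal value whose multiplicity count is [j]. *)
      destruct (mult_attained h (h i) j i) as [i' [A1 [A2 A3]]]; [unfold k in *; lia|].
      destruct (HR i') as [j' [J1 J2]]; [lia|]. exists j'; split; [exact J1|].
      rewrite J2. unfold k. now rewrite A2, A3. }
    destruct (finite_pos_bound (fun i r => r <= 1 - H i) n) as [r5 [r5p Q5]].
    { intros; lra. }
    { intros i Hi; exists (1 - H i). destruct (HB i Hi); split; lra. }
    set (r6 := Rmin (Rmin r2 r5) 1 / 2).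
    assert (r6p : 0 < r6 /\ r6 < r2 /\ r6 < r5 /\ r6 < 1).
    { unfold r6. assert (M1 := Rmin_l (Rmin r2 r5) 1). assert (M2 := Rmin_r (Rmin r2 r5) 1).
      assert (M3 := Rmin_l r2 r5). assert (M4 := Rmin_r r2 r5).
      assert (0 < Rmin (Rmin r2 r5) 1) by (repeat apply Rmin_glb_lt; lra). lra. }
    set (del := r6 / INR n).
    assert (delp : 0 < del) by (apply Rdiv_lt_0_compat; lra).
    assert (deln : INR n * del = r6) by (unfold del; field; lra).
    assert (dstep : forall m, (m <= n)%nat -> INR m * del <= r6).
    { intros m Hm. rewrite <- deln. apply Rmult_le_compat_r; [lra|now apply le_INR]. }
    (* A cluster just below 1 standing for the exponent 1 of multiplicity [n]: [r6 < r5] places it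
       above all [H j], and [r6 < 1] keeps it positive. *)
    set (E := fun j => 1 - INR (n - j) * del).
    assert (EE : exponents n E).
    { split; unfold E.
      - assert (D := dstep (n - 0)%nat ltac:(lia)). lra.
      - intros j Hj. replace (n - j)%nat with (S (n - S j)) by lia.
        rewrite S_INR. lra. }
    destruct (weights_monotone l t n H E c Hl Ht HE EE) as [c' [Hc' Hcc]];
      [|exact Hc|].
    { intros j Hj. unfold E. assert (D := dstep (n - j)%nat ltac:(lia)).
      specialize (Q5 j Hj). lra. }
    destruct (Q2 E c' del delp) as [u [U1 U2]]; [lra|exact Hc'| |].
    { intros i j Hi Hj. exists (n - S j)%nat; split; [lia|].
      unfold E. now replace (n - (n - S j))%nat with (S j) by lia. }
    set (C := rsum (fun i => Rabs (c' i)) n).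
    assert (L1 : A <= eta + (1 + eta) * C).
    { assert (T := Rabs_triang (quasi a k n l h s - (-1) ^ l * rsum (fun i => c i * v i) n)
        ((-1) ^ l * rsum (fun i => c i * v i) n)).
      match type of T with Rabs ?x <= _ =>
        replace x with (quasi a k n l h s) in T by ring end.
      fold A in T. rewrite (Rabs_mult ((-1) ^ l)), Rabs_sign in T.
      assert (B := Rabs_rsum (fun i => c i * v i) n).
      assert (rsum (fun i => Rabs (c i * v i)) n <= (1 + eta) * C).
      { unfold C. rewrite <- rsum_scal. apply rsum_le. intros i Hi.
        rewrite Rabs_mult. specialize (Hcc i Hi). specialize (V1 i Hi).
        assert (ti := nodes_ge0 n t i Ht Hi).
        assert (Ha' := Ha (t i + s) ltac:(lra)).
        assert (Rabs (v i) <= 1 + eta).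
        { replace (v i) with ((v i - quasi a k n 0 h (t i + s)) + quasi a k n 0 h (t i + s)) by ring.
          eapply Rle_trans; [apply Rabs_triang|lra]. }
        rewrite Rmult_comm. apply Rmult_le_compat; auto; apply Rabs_pos. }
      lra. }
    assert (L2 : (1 - eta) * C <= K + eta).
    { assert (B : (1 - eta) * C <= sg * rsum (fun i => c' i * u i) n).
      { unfold C. rewrite <- !rsum_scal. apply rsum_le. intros i Hi.
        assert (P := weights_sign l t n E c' i Hl Ht EE Hc' Hi).
        replace (Rabs (c' i)) with ((-1) ^ i * c' i).
        2:{ rewrite <- (Rabs_pos_eq ((-1) ^ i * c' i)) by lra.
            rewrite Rabs_mult, Rabs_sign; ring. }
        specialize (U1 i Hi). specialize (Hq i Hi). rewrite Rplus_0_r in U1.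
        assert (X : Rabs (sg * (-1) ^ i * (u i - quasi q (fun i => i) n 0 (fun _ => 1) (t i))) < eta).
        { rewrite !Rabs_mult, Hsg, Rabs_sign. lra. }
        apply Rabs_def2 in X.
        assert (Y : 1 - eta <= sg * (-1) ^ i * u i) by lra.
        replace (sg * (c' i * u i)) with (((-1) ^ i * (-1) ^ i) * (sg * (c' i * u i)))
          by (rewrite sign_sqr; ring).
        replace ((-1) ^ i * (-1) ^ i * (sg * (c' i * u i)))
          with ((sg * (-1) ^ i * u i) * ((-1) ^ i * c' i)) by ring.
        apply Rmult_le_compat_r; lra. }
      assert (T := Rabs_triang_inv ((-1) ^ l * rsum (fun i => c' i * u i) n)
        (quasi q (fun i => i) n l (fun _ => 1) 0)).
      rewrite Rabs_minus_sym in T. fold K in T.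
      rewrite (Rabs_mult ((-1) ^ l)), Rabs_sign in T.
      assert (B' := Rle_abs (sg * rsum (fun i => c' i * u i) n)).
      rewrite Rabs_mult, Hsg in B'. lra. }
    nra. }
  apply Rnot_lt_le; intros Hlt.
  (* Expanded, [main] reads [A - K <= eta * (A + K + 2)]; this [eta] makes the right side at most
     [(A - K) / 2]. *)
  set (eta := Rmin (/ 2) ((A - K) / (2 * (A + K + 2)))).
  assert (E1 : eta <= / 2) by apply Rmin_l.
  assert (E2 : eta <= (A - K) / (2 * (A + K + 2))) by apply Rmin_r.
  assert (E0 : 0 < eta).
  { apply Rmin_glb_lt; [lra|]. apply Rdiv_lt_0_compat; lra. }
  specialize (main eta ltac:(lra)).
  apply (Rmult_le_compat_r (A + K + 2)) in E2; [|lra].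
  replace ((A - K) / (2 * (A + K + 2)) * (A + K + 2)) with ((A - K) / 2) in E2
    by (field; lra).
  nra.
Qed.

Lemma inRP_quasi n h p : inRP n h p ->
  exists a, forall l t, Derive_n p l t = quasi a (fun i => Defs.mult h (h i) i) n l h t.
Proof.
  intros [a Ha]; exists a; intros l t.
  unfold quasi. rewrite <- Derive_n_quasipoly.
  apply Derive_n_ext; intros u. apply Ha.
Qed.

Lemma Derive_n_laguerre n q l t :
  Derive_n (fun t => exp (- t) * polyv n q t) l t = quasi q (fun i => i) n l (fun _ => 1) t.
Proof.
  unfold quasi. rewrite <- (Derive_n_quasipoly q (fun _ => 1) (fun i => i)).
  apply Derive_n_ext; intros u. unfold polyv. rewrite <- rsum_scal.
  apply rsum_ext; intros i _. replace (- (1) * u) with (- u) by ring. ring.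
Qed.

Theorem comparison l n t sg q h p s :
  (1 <= n)%nat -> nodes n t -> Rabs sg = 1 ->
  (forall i, (i < n)%nat -> 1 <= sg * (-1) ^ i * (exp (- t i) * polyv n q (t i))) ->
  inI n h -> inRP n h p -> (forall u, 0 <= u -> Rabs (p u) <= 1) -> 0 <= s ->
  Rabs (Derive_n p l s) <= Rabs (Derive_n (fun t => exp (- t) * polyv n q t) l 0).
Proof.
  intros Hn Ht Hsg Hq Hh Hp Hb Hs.
  destruct (inRP_quasi n h p Hp) as [a Ha].
  rewrite Ha, Derive_n_laguerre. apply (comparison_quasi l n t sg); auto.
  - intros i Hi. rewrite <- (Derive_n_laguerre n q 0). now apply Hq.
  - intros u Hu. rewrite <- (Ha O u). now apply Hb.
Qed.

(** * Decay and extrema *)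

(** From [u <= exp u] with [u = h * t / K] one gets [t <= K / h * exp (h * t / K)]; the [K]-th
    power, where [K] is the exponent of [t], gives the bound. *)
Lemma pow_exp_bounded k h :
  0 < h -> exists C, forall t, 0 <= t -> t ^ k * exp (- h * t) <= C.
Proof.
  intros Hh. destruct k as [|k].
  - exists 1. intros t Ht. rewrite pow_O, Rmult_1_l.
    rewrite <- exp_0. destruct (Rle_lt_or_eq_dec 0 t Ht) as [Hp|<-].
    + left; apply exp_increasing; nra.
    + right; f_equal; ring.
  - set (K := INR (S k)). assert (K0 : 0 < K) by (apply lt_0_INR; lia).
    exists ((K / h) ^ S k). intros t Ht.
    assert (A : t <= K / h * exp (h * t / K)).
    { assert (B := exp_ineq1_le (h * t / K)).
      assert (0 < K / h) by now apply Rdiv_lt_0_compat.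
      apply Rle_trans with (K / h * (h * t / K)); [right; field; lra|].
      apply Rmult_le_compat_l; lra. }
    assert (B : t ^ S k <= (K / h * exp (h * t / K)) ^ S k) by (apply pow_incr; lra).
    rewrite Rpow_mult_distr in B.
    assert (C : exp (h * t / K) ^ S k = exp (h * t)).
    { rewrite <- Rpower_pow by apply exp_pos. unfold Rpower. rewrite ln_exp.
      f_equal. fold K. field; lra. }
    rewrite C in B. assert (E := exp_pos (- h * t)).
    apply Rle_trans with ((K / h) ^ S k * exp (h * t) * exp (- h * t)).
    + apply Rmult_le_compat_r; lra.
    + rewrite Rmult_assoc, <- exp_plus. replace (h * t + - h * t) with 0 by ring.
      rewrite exp_0; lra.
Qed.

Definition vanishing (f : R -> R) : Prop :=
  forall eta, 0 < eta -> exists A, 0 < A /\ forall t, A <= t -> Rabs (f t) < eta.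

(** Boundedness of [t^(n+1) * exp (- t)] makes the term of degree [n] of order [1 / t]. *)
Lemma vanishing_laguerre n c : vanishing (fun t => exp (- t) * polyv n c t).
Proof.
  unfold polyv; induction n as [|n IH]; intros eta He; simpl.
  - exists 1; split; [lra|]. intros. rewrite Rmult_0_r, Rabs_R0; lra.
  - destruct (IH (eta / 2)) as [A [A0 HA]]; [lra|].
    destruct (pow_exp_bounded (S n) 1) as [C HC]; [lra|].
    set (B := 2 * (Rabs (c n) * Rabs C) / eta + 1).
    assert (P : 0 <= Rabs (c n) * Rabs C) by (apply Rmult_le_pos; apply Rabs_pos).
    assert (B0 : 0 < B).
    { unfold B. assert (0 <= 2 * (Rabs (c n) * Rabs C) / eta); [|lra].
      apply Rdiv_le_0_compat; lra. }
    exists (Rmax A B); split; [eapply Rlt_le_trans; [exact B0|apply Rmax_r]|].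
    intros t Ht. assert (M1 := Rmax_l A B). assert (M2 := Rmax_r A B).
    rewrite Rmult_plus_distr_l. eapply Rle_lt_trans; [apply Rabs_triang|].
    assert (H1 := HA t ltac:(lra)). assert (H2 := HC t ltac:(lra)).
    replace (- (1) * t) with (- t) in H2 by ring.
    assert (H3 : Rabs (exp (- t) * (c n * t ^ n)) < eta / 2); [|lra].
    rewrite !Rabs_mult, (Rabs_pos_eq (exp _)) by (apply Rlt_le, exp_pos).
    rewrite (Rabs_pos_eq (t ^ n)) by (apply pow_le; lra).
    assert (t0 : 0 < t) by lra.
    apply (Rmult_lt_reg_r t); [exact t0|].
    apply Rle_lt_trans with (Rabs (c n) * Rabs C).
    + replace (exp (- t) * (Rabs (c n) * t ^ n) * t)
        with (Rabs (c n) * (t ^ S n * exp (- t))) by (simpl; ring).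
      apply Rmult_le_compat_l; [apply Rabs_pos|].
      eapply Rle_trans; [exact H2|apply Rle_abs].
    + assert (t > 2 * (Rabs (c n) * Rabs C) / eta) by (unfold B in *; lra).
      apply (Rmult_lt_compat_r (eta / 2)) in H; [|lra].
      replace (2 * (Rabs (c n) * Rabs C) / eta * (eta / 2)) with (Rabs (c n) * Rabs C) in H
        by (field; lra). lra.
Qed.

Lemma interior_max (f f' : R -> R) a b c :
  (forall x, is_derive f x (f' x)) -> a < c < b -> f a < f c -> f b < f c ->
  exists X, a < X < b /\ f' X = 0 /\ f c <= f X /\ forall x, a <= x <= b -> f x <= f X.
Proof.
  intros Hf Hc Ha Hb.
  destruct (continuity_ab_maj f a b) as [X [HX HX']]; [lra| |].
  { intros x _; eapply is_derive_continuity, Hf. }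
  assert (Hcx : f c <= f X) by (apply HX; lra).
  assert (Hin : a < X < b).
  { split; apply Rnot_le_lt; intros Hle.
    - assert (X = a) by lra. subst; lra.
    - assert (X = b) by lra. subst; lra. }
  exists X; repeat split; try lra; [|exact HX].
  assert (D := Hf X). apply is_derive_Reals in D.
  assert (E := deriv_maximum f a b X (exist _ _ D) (proj1 Hin) (proj2 Hin)).
  simpl in E. apply E. intros x H1 H2. apply HX; lra.
Qed.

(** The tool for proving [|f| <= |f 0|]: a violation yields a critical point with at least as large
    a modulus, which the equation satisfied by [f] can exclude. *)
Lemma vanishing_extremum (f f' : R -> R) s :
  (forall x, is_derive f x (f' x)) -> vanishing f ->
  0 <= s -> Rabs (f 0) < Rabs (f s) ->
  exists X, 0 < X /\ f' X = 0 /\ Rabs (f s) <= Rabs (f X).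
Proof.
  intros Hf Hv Hs Hlt.
  assert (P := Rabs_pos (f 0)).
  destruct (Hv (Rabs (f s))) as [A [A0 HA]]; [lra|].
  assert (s0 : 0 < s).
  { destruct Hs as [|<-]; [assumption|lra]. }
  set (sg := if Rcase_abs (f s) then -1 else 1).
  assert (Esg : Rabs (f s) = sg * f s).
  { unfold sg, Rabs. destruct (Rcase_abs (f s)); ring. }
  assert (Lsg : forall x, sg * f x <= Rabs (f x)).
  { intros x. unfold sg. destruct (Rcase_abs (f s)).
    - replace (-1 * f x) with (- f x) by ring. rewrite <- Rabs_Ropp. apply Rle_abs.
    - rewrite Rmult_1_l. apply Rle_abs. }
  assert (M1 := Rmax_l A (s + 1)). assert (M2 := Rmax_r A (s + 1)).
  destruct (interior_max (fun x => sg * f x) (fun x => sg * f' x) 0 (Rmax A (s + 1)) s)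
    as [X [HX [D [L _]]]].
  - intros x. apply is_derive_scal, Hf.
  - lra.
  - rewrite <- Esg. eapply Rle_lt_trans; [apply Lsg|exact Hlt].
  - rewrite <- Esg. eapply Rle_lt_trans; [apply Lsg|]. apply HA; lra.
  - exists X; repeat split; [lra| |].
    + apply Rmult_integral in D. destruct D as [D|]; [|assumption].
      exfalso. unfold sg in D. destruct (Rcase_abs (f s)); lra.
    + rewrite Esg. eapply Rle_trans; [exact L|apply Lsg].
Qed.

(** * Suprema and the sup norm *)

(** As [real] sends infinite values to 0, a member and an upper bound are supplied to make the
    supremum finite. *)
Lemma real_Lub_Rbar (E : R -> Prop) y0 M :
  E y0 -> (forall y, E y -> y <= M) ->
  (forall y, E y -> y <= real (Lub_Rbar E)) /\ real (Lub_Rbar E) <= M.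
Proof.
  intros H0 HM. destruct (Lub_Rbar_correct E) as [Hub Hlub].
  assert (A := Hlub (Finite M) HM). assert (B := Hub y0 H0).
  destruct (Lub_Rbar E) as [r| |]; try contradiction.
  split; [exact Hub|exact A].
Qed.

Lemma supnorm_le f M :
  (forall t, 0 <= t -> Rabs (f t) <= M) -> supnorm f <= M.
Proof.
  intros H. apply (real_Lub_Rbar _ (Rabs (f 0))).
  - exists 0; split; [lra|reflexivity].
  - intros y [t [Ht ->]]. now apply H.
Qed.

Lemma le_supnorm f M t :
  (forall t, 0 <= t -> Rabs (f t) <= M) -> 0 <= t -> Rabs (f t) <= supnorm f.
Proof.
  intros H Ht. apply (real_Lub_Rbar _ (Rabs (f t)) M).
  - now exists t.
  - intros y [u [Hu ->]]. now apply H.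
  - now exists t.
Qed.

(** * The Chebyshev polynomial with Laguerre weight *)

(** The coefficient of [f (t i)] in the divided difference of [f] at [t 0, ..., t m], a functional
    that reads off the leading coefficient of a polynomial of degree [m]. *)
Definition divdiff (t : nat -> R) (m i : nat) : R :=
  / rprod (fun j => t i - t (skip i j)) m.

Definition distinct (m : nat) (t : nat -> R) : Prop :=
  forall i j, (i <= m)%nat -> (j <= m)%nat -> i <> j -> t i <> t j.

Lemma skip_ne i j : skip i j <> i.
Proof. unfold skip; destruct (Nat.ltb_spec j i); lia. Qed.

Lemma distinct_rprod t m i :
  distinct m t -> (i <= m)%nat -> rprod (fun j => t i - t (skip i j)) m <> 0.
Proof.
  intros H Hi. apply rprod_neq0; intros j Hj E.
  apply (H i (skip i j)); [exact Hi| |apply not_eq_sym, skip_ne|lra].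
  assert (A := skip_lt i j m Hi Hj). lia.
Qed.

Lemma divdiff_last t m f :
  distinct (S m) t ->
  rsum (fun i => divdiff t (S m) i * (t i - t (S m)) * f i) (S (S m))
  = rsum (fun i => divdiff t m i * f i) (S m).
Proof.
  intros H. change (rsum ?g (S (S m))) with (rsum g (S m) + g (S m)). cbv beta.
  rewrite Rminus_diag, Rmult_0_r, Rmult_0_l, Rplus_0_r.
  apply rsum_ext; intros i Hi. f_equal. unfold divdiff. simpl rprod.
  assert (E : skip i m = S m).
  { unfold skip; destruct (Nat.ltb_spec m i); [lia|reflexivity]. }
  rewrite E.
  assert (N1 : rprod (fun j => t i - t (skip i j)) m <> 0).
  { apply distinct_rprod; [|lia]. intros a b Ha Hb; apply H; lia. }
  assert (N2 := H i (S m) ltac:(lia) ltac:(lia) ltac:(lia)).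
  field. split; first [lra | exact N1].
Qed.

Lemma rprod_S_l f m : rprod f (S m) = f O * rprod (fun j => f (S j)) m.
Proof. induction m as [|m IH]; simpl in *; [ring|rewrite IH; ring]. Qed.

Lemma divdiff_first t m f :
  distinct (S m) t ->
  rsum (fun i => divdiff t (S m) i * (t i - t O) * f i) (S (S m))
  = rsum (fun i => divdiff (fun j => t (S j)) m i * f (S i)) (S m).
Proof.
  intros H. rewrite rsum_S_l, Rminus_diag, Rmult_0_r, Rmult_0_l, Rplus_0_l.
  apply rsum_ext; intros i Hi. f_equal. unfold divdiff. rewrite rprod_S_l.
  rewrite (rprod_ext (fun j => t (S i) - t (skip (S i) (S j)))
    (fun j => t (S i) - t (S (skip i j)))).
  2:{ intros j Hj. unfold skip.
      destruct (Nat.ltb_spec (S j) (S i)), (Nat.ltb_spec j i); try lia; reflexivity. }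
  change (skip (S i) 0) with O.
  assert (N1 : rprod (fun j => t (S i) - t (S (skip i j))) m <> 0).
  { apply (distinct_rprod (fun j => t (S j))); [|lia].
    intros a b Ha Hb Hab; apply H; lia. }
  assert (N2 := H (S i) O ltac:(lia) ltac:(lia) ltac:(lia)).
  field. split; first [lra | exact N1].
Qed.

(** Multiplying by [t i - t (S m)] or by [t i - t 0] removes one node, and by induction both
    reductions give the same number. Their difference is [t (S m) - t 0] times the sum, which
    therefore vanishes. *)
Lemma divdiff_one m : forall t, distinct m t ->
  rsum (divdiff t m) (S m) = if Nat.eq_dec m 0 then 1 else 0.
Proof.
  induction m as [|m IH]; intros t H.
  - simpl. unfold divdiff; simpl. field.
  - assert (A := divdiff_last t m (fun _ => 1) H).
    assert (B := divdiff_first t m (fun _ => 1) H).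
    assert (H1 : distinct m t) by (intros a b Ha Hb; apply H; lia).
    assert (H2 : distinct m (fun j => t (S j))).
    { intros a b Ha Hb Hab; apply H; lia. }
    assert (E1 : rsum (fun i => divdiff t m i * 1) (S m) = rsum (divdiff t m) (S m)).
    { apply rsum_ext; intros; ring. }
    assert (E2 : rsum (fun i => divdiff (fun j => t (S j)) m i * 1) (S m)
      = rsum (divdiff (fun j => t (S j)) m) (S m)).
    { apply rsum_ext; intros; ring. }
    cbv beta in A, B. rewrite E1, IH in A by exact H1. rewrite E2, IH in B by exact H2.
    rewrite <- A in B. apply Rminus_diag_eq in B. rewrite <- rsum_minus in B.
    rewrite (rsum_ext _ (fun i => (t (S m) - t O) * divdiff t (S m) i)) in B.
    2:{ intros; ring. }
    rewrite rsum_scal in B. apply Rmult_integral in B.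
    destruct (Nat.eq_dec (S m) 0); [lia|].
    destruct B as [B|B]; [|exact B].
    exfalso; apply (H (S m) O); lia || lra.
Qed.

(** Writing [x^(k+1) = (x - t (S m)) * x^k + t (S m) * x^k] lowers the number of nodes in one term
    and the power in the other. *)
Lemma divdiff_pow m : forall t k, distinct m t -> (k <= m)%nat ->
  rsum (fun i => divdiff t m i * t i ^ k) (S m) = if Nat.eq_dec k m then 1 else 0.
Proof.
  induction m as [|m IH]; intros t k H Hk.
  - replace k with O by lia. simpl. unfold divdiff; simpl. field.
  - induction k as [|k IHk].
    + rewrite (rsum_ext _ (divdiff t (S m))) by (intros; simpl; ring).
      rewrite divdiff_one by exact H.
      destruct (Nat.eq_dec (S m) 0), (Nat.eq_dec 0 (S m)); try lia; reflexivity.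
    + assert (A := divdiff_last t m (fun i => t i ^ k) H).
      cbv beta in A. rewrite IH in A by (lia || (intros a b Ha Hb; apply H; lia)).
      specialize (IHk ltac:(lia)).
      rewrite (rsum_ext _ (fun i => divdiff t (S m) i * (t i - t (S m)) * t i ^ k
        + t (S m) * (divdiff t (S m) i * t i ^ k))) by (intros; simpl; ring).
      rewrite rsum_plus, rsum_scal, A, IHk.
      destruct (Nat.eq_dec k m), (Nat.eq_dec k (S m)), (Nat.eq_dec (S k) (S m)); try lia; ring.
Qed.

Lemma divdiff_polyv m t c : distinct m t ->
  rsum (fun i => divdiff t m i * polyv (S m) c (t i)) (S m) = c m.
Proof.
  intros H. unfold polyv.
  rewrite (rsum_ext _ (fun i => rsum (fun k => c k * (divdiff t m i * t i ^ k)) (S m))).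
  2:{ intros; rewrite <- rsum_scal; apply rsum_ext; intros; ring. }
  rewrite rsum_swap.
  rewrite (rsum_ext _ (fun k => if Nat.eq_dec k m then c k else 0)).
  2:{ intros k Hk. rewrite rsum_scal, divdiff_pow by (lia || exact H).
      destruct (Nat.eq_dec k m); ring. }
  simpl. rewrite rsum_0.
  - destruct (Nat.eq_dec m m); [ring|lia].
  - intros i Hi. destruct (Nat.eq_dec i m); [lia|reflexivity].
Qed.

Lemma polyv_interpolation m t y : distinct m t ->
  exists c, forall i, (i <= m)%nat -> polyv (S m) c (t i) = y i.
Proof.
  intros H.
  destruct (newton_interpolation (fun k x => x ^ k) t (S m)) with (y := y) as [c Hc].
  - intros k w Hk Hz.
    set (c := fun i => if Nat.eq_dec i k then 1 else w i).
    assert (E := divdiff_polyv k t c). rewrite rsum_0 in E.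
    + unfold c in E. destruct (Nat.eq_dec k k); [|lia].
      enough (0 = 1) by lra. apply E. intros a b Ha Hb; apply H; lia.
    + intros i Hi. specialize (Hz i ltac:(lia)). unfold polyv, c. simpl.
      destruct (Nat.eq_dec k k); [|lia].
      rewrite (rsum_ext _ (fun j => w j * t i ^ j)).
      * rewrite Rmult_1_l, Rplus_comm, Hz. ring.
      * intros j Hj. destruct (Nat.eq_dec j k); [lia|reflexivity].
  - exists c. intros i Hi. apply Hc. lia.
Qed.

Lemma is_derive_polyv N c x :
  is_derive (polyv (S N) c) x (polyv N (fun k => INR (S k) * c (S k)) x).
Proof.
  unfold polyv; induction N as [|N IH].
  - simpl. auto_derive; [auto|ring].
  - change (rsum ?f (S N)) with (rsum f N + f N).
    apply (is_derive_plus (V := R_NormedModule)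
      (fun x => rsum (fun k => c k * x ^ k) (S N)) (fun x => c (S N) * x ^ S N));
      [exact IH|].
    rewrite (Rmult_comm (INR _)), Rmult_assoc. apply is_derive_scal.
    auto_derive; [auto|]. rewrite S_INR. destruct N; simpl; ring.
Qed.

Lemma is_derive_laguerre N c x :
  is_derive (fun t => exp (- t) * polyv (S N) c t) x
    (exp (- x) * (polyv N (fun k => INR (S k) * c (S k)) x - polyv (S N) c x)).
Proof.
  replace (exp (- x) * (polyv N (fun k => INR (S k) * c (S k)) x - polyv (S N) c x))
    with (- exp (- x) * polyv (S N) c x
          + exp (- x) * polyv N (fun k => INR (S k) * c (S k)) x) by ring.
  apply (is_derive_mult (fun t => exp (- t)) (polyv (S N) c));
    [|apply is_derive_polyv|intros; apply Rmult_comm].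
  auto_derive; [auto|ring].
Qed.

Lemma nodes_distinct m t : nodes (S m) t -> distinct m t.
Proof.
  intros [_ Ht] i j Hi Hj Hij E.
  destruct (Nat.lt_ge_cases i j).
  - assert (t i < t j) by (apply (increasing_lt t (S m)); [exact Ht|lia]). lra.
  - assert (t j < t i) by (apply (increasing_lt t (S m)); [exact Ht|lia]). lra.
Qed.

Lemma rprod_opp f m : rprod (fun j => - f j) m = (-1) ^ m * rprod f m.
Proof. induction m as [|m IH]; simpl; [ring|rewrite IH; ring]. Qed.

Lemma divdiff_sign m t i : nodes (S m) t -> (i <= m)%nat ->
  (-1) ^ m * divdiff t m i = (-1) ^ i * Rabs (divdiff t m i).
Proof.
  intros Ht Hi. unfold divdiff.
  assert (A := rprod_skip_sign t m i Hi (proj2 Ht)).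
  rewrite (rprod_ext _ (fun j => - (t (skip i j) - t i))) by (intros; ring).
  rewrite rprod_opp. set (p := rprod _ m) in *.
  assert (p0 : p <> 0) by (intros E; rewrite E in A; lra).
  rewrite Rinv_mult, Rabs_mult, (Rabs_inv ((-1) ^ m)), Rabs_sign, Rinv_1, Rmult_1_l.
  rewrite Rabs_inv.
  replace (Rabs p) with ((-1) ^ i * p).
  2:{ rewrite <- (Rabs_pos_eq ((-1) ^ i * p)) by lra.
      rewrite Rabs_mult, Rabs_sign; ring. }
  assert (S1 := sign_sqr m). assert (S2 := sign_sqr i).
  assert (N1 : (-1) ^ m <> 0) by (apply pow_nonzero; lra).
  assert (N2 : (-1) ^ i <> 0) by (apply pow_nonzero; lra).
  field. auto.
Qed.

(* The modulus of the leading coefficient of the polynomial of degree [m] taking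
   the values [(-1)^i * exp (t i)] at the nodes; the Chebyshev polynomial minimises it. *)
Definition leading (m : nat) (t : nat -> R) : R :=
  rsum (fun i => exp (t i) * Rabs (divdiff t m i)) (S m).

Lemma leading_polyv m t c : nodes (S m) t ->
  (-1) ^ m * c m = rsum (fun i => (-1) ^ i * polyv (S m) c (t i) * Rabs (divdiff t m i)) (S m).
Proof.
  intros Ht. rewrite <- (divdiff_polyv m t c) by now apply nodes_distinct.
  rewrite <- rsum_scal. apply rsum_ext. intros i Hi.
  rewrite <- Rmult_assoc, divdiff_sign by (auto; lia). ring.
Qed.

(** * Compactness and minimising nodes *)

Lemma bolzano_weierstrass (u : nat -> R) B :
  (forall k, Rabs (u k) <= B) ->
  exists phi l, (forall k, (phi k < phi (S k))%nat) /\
    is_lim_seq (fun k => u (phi k)) (Finite l).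
Proof.
  intros Hu.
  destruct (Bolzano_Weierstrass u (fun x => - B <= x <= B)) as [l Hl].
  - apply compact_P3.
  - intros k. apply Rabs_le_between, Hu.
  - assert (pick : forall N k, exists p, (N <= p)%nat /\ Rabs (u p - l) < / INR (S k)).
    { intros N k.
      assert (P : 0 < / INR (S k)) by (apply Rinv_0_lt_compat, lt_0_INR; lia).
      destruct (Hl (disc l (mkposreal _ P)) N) as [p [H1 H2]].
      - exists (mkposreal _ P). intros x Hx; exact Hx.
      - exists p; split; [exact H1|exact H2]. }
    set (next := fun N k => proj1_sig (constructive_indefinite_description _ (pick N k))).
    assert (Hnext : forall N k, (N <= next N k)%nat /\ Rabs (u (next N k) - l) < / INR (S k)).
    { intros N k. unfold next. now destruct (constructive_indefinite_description _ (pick N k)). }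
    set (phi := fix phi k := match k with O => next O O | S k' => next (S (phi k')) (S k') end).
    exists phi, l; split.
    + intros k. simpl. destruct (Hnext (S (phi k)) (S k)) as [A _]. lia.
    + apply (is_lim_seq_le_le (fun k => l - / INR (S k)) _ (fun k => l + / INR (S k))).
      * intros k. assert (A : Rabs (u (phi k) - l) < / INR (S k)).
        { destruct k; simpl phi; apply Hnext. }
        apply Rabs_def2 in A. lra.
      * replace (Finite l) with (Finite (l - 0)) by (f_equal; ring).
        apply is_lim_seq_minus'; [apply is_lim_seq_const|].
        apply (is_lim_seq_inv (fun k => INR (S k)) p_infty); [|discriminate].
        apply (is_lim_seq_incr_1 INR), is_lim_seq_INR.
      * replace (Finite l) with (Finite (l + 0)) by (f_equal; ring).
        apply is_lim_seq_plus'; [apply is_lim_seq_const|].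
        apply (is_lim_seq_inv (fun k => INR (S k)) p_infty); [|discriminate].
        apply (is_lim_seq_incr_1 INR), is_lim_seq_INR.
Qed.

Lemma bolzano_weierstrass_vec n (x : nat -> nat -> R) B :
  (forall k i, (i < n)%nat -> Rabs (x k i) <= B) ->
  exists phi L, (forall k, (phi k < phi (S k))%nat) /\
    forall i, (i < n)%nat -> is_lim_seq (fun k => x (phi k) i) (Finite (L i)).
Proof.
  induction n as [|n IH]; intros Hx.
  - exists (fun k => k), (fun _ => 0); split; intros; lia.
  - destruct IH as [phi [L [Hphi HL]]]; [auto|].
    destruct (bolzano_weierstrass (fun k => x (phi k) n) B) as [psi [l [Hpsi Hl]]].
    { intros k; apply Hx; lia. }
    exists (fun k => phi (psi k)), (fun i => if Nat.eq_dec i n then l else L i).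
    split.
    + assert (Hmono : forall a b, (a < b)%nat -> (phi a < phi b)%nat).
      { intros a b Hab; induction Hab as [|b Hab IHab]; [apply Hphi|].
        eapply Nat.lt_trans; [exact IHab|apply Hphi]. }
      intros k. apply Hmono, Hpsi.
    + intros i Hi. destruct (Nat.eq_dec i n) as [->|]; [exact Hl|].
      apply (is_lim_seq_subseq (fun k => x (phi k) i)).
      * now apply eventually_subseq.
      * apply HL; lia.
Qed.

Lemma is_lim_seq_rsum n (f : nat -> nat -> R) L :
  (forall i, (i < n)%nat -> is_lim_seq (fun k => f k i) (Finite (L i))) ->
  is_lim_seq (fun k => rsum (f k) n) (Finite (rsum L n)).
Proof.
  induction n as [|n IH]; intros H; simpl; [apply is_lim_seq_const|].
  apply is_lim_seq_plus'; auto.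
Qed.

Lemma is_lim_seq_rprod n (f : nat -> nat -> R) L :
  (forall i, (i < n)%nat -> is_lim_seq (fun k => f k i) (Finite (L i))) ->
  is_lim_seq (fun k => rprod (f k) n) (Finite (rprod L n)).
Proof.
  induction n as [|n IH]; intros H; simpl; [apply is_lim_seq_const|].
  apply is_lim_seq_mult'; auto.
Qed.

Lemma leading_continuous m (x : nat -> nat -> R) t :
  distinct m t ->
  (forall i, (i <= m)%nat -> is_lim_seq (fun k => x k i) (Finite (t i))) ->
  is_lim_seq (fun k => leading m (x k)) (Finite (leading m t)).
Proof.
  intros Ht Hx. apply (is_lim_seq_rsum (S m)
    (fun k i => exp (x k i) * Rabs (divdiff (x k) m i))).
  intros i Hi. apply is_lim_seq_mult'.
  - apply (is_lim_seq_continuous exp); [|apply Hx; lia].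
    apply derivable_continuous_pt, derivable_pt_exp.
  - apply (is_lim_seq_abs _ (Finite (divdiff t m i))).
    apply (is_lim_seq_inv _ (Finite (rprod (fun j => t i - t (skip i j)) m))).
    + apply (is_lim_seq_rprod m (fun k j => x k i - x k (skip i j))).
      intros j Hj. assert (A := skip_lt i j m ltac:(lia) Hj).
      apply is_lim_seq_minus'; apply Hx; lia.
    + intros E. injection E. apply distinct_rprod; [exact Ht|lia].
Qed.

Lemma Rabs_rprod_le f m A :
  1 <= A -> (forall j, (j < m)%nat -> Rabs (f j) <= A) -> Rabs (rprod f m) <= A ^ m.
Proof.
  intros HA H; induction m as [|m IH]; simpl; [rewrite Rabs_R1; lra|].
  rewrite Rabs_mult, Rmult_comm. apply Rmult_le_compat; auto; apply Rabs_pos.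
Qed.

Lemma Rabs_rprod_le_factor f m A j :
  1 <= A -> (forall j, (j < m)%nat -> Rabs (f j) <= A) -> (j < m)%nat ->
  Rabs (rprod f m) <= Rabs (f j) * A ^ m.
Proof.
  intros HA H Hj; induction m as [|m IH]; [lia|]. simpl. rewrite Rabs_mult.
  assert (P : 0 < A ^ m) by (apply pow_lt; lra).
  assert (Q := Rabs_pos (f j)).
  destruct (Nat.eq_dec j m) as [->|].
  - assert (B : Rabs (rprod f m) <= A ^ m) by (apply Rabs_rprod_le; auto).
    apply Rle_trans with (A ^ m * Rabs (f m)); [apply Rmult_le_compat_r; lra|].
    rewrite Rmult_comm. apply Rmult_le_compat_l; nra.
  - rewrite (Rmult_comm A), <- Rmult_assoc.
    apply Rmult_le_compat; auto; try apply Rabs_pos.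
    apply IH; [auto|lia].
Qed.

(** A bound on [leading] bounds the products of node distances from below. For [i = m] exponential
    growth then keeps the nodes bounded; for the other [i] it keeps [t i] away from [t (S i)]. *)
Lemma leading_term m t M i : nodes (S m) t -> leading m t <= M -> (i <= m)%nat ->
  exp (t i) <= M * Rabs (rprod (fun j => t i - t (skip i j)) m).
Proof.
  intros Ht HM Hi.
  assert (A := rsum_ge_term (fun i => exp (t i) * Rabs (divdiff t m i)) (S m) i
    ltac:(lia)). simpl in A.
  assert (B : exp (t i) * Rabs (divdiff t m i) <= M).
  { eapply Rle_trans; [apply A|exact HM].
    intros j _; apply Rmult_le_pos; [apply Rlt_le, exp_pos|apply Rabs_pos]. }
  assert (N := distinct_rprod t m i (nodes_distinct m t Ht) Hi).
  unfold divdiff in B. rewrite Rabs_inv in B.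
  set (p := Rabs (rprod (fun j => t i - t (skip i j)) m)) in *. assert (p0 : 0 < p) by now apply Rabs_pos_lt.
  apply (Rmult_le_compat_r p) in B; [|lra].
  rewrite Rmult_assoc, Rinv_l, Rmult_1_r in B by lra. exact B.
Qed.

Lemma node_le_last m t i : nodes (S m) t -> (i <= m)%nat -> 0 <= t i <= t m.
Proof.
  intros Ht Hi; split; [apply (nodes_ge0 (S m)); [exact Ht|lia]|].
  destruct (Nat.eq_dec i m) as [->|]; [lra|].
  apply Rlt_le, (increasing_lt t (S m)); [apply Ht|lia].
Qed.

Lemma leading_coercive m M :
  exists A, 1 <= A /\ forall t, nodes (S m) t -> leading m t <= M -> t m <= A.
Proof.
  destruct (vanishing_laguerre (S m) (fun k => if Nat.eq_dec k m then 1 else 0)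
    (/ (Rabs M + 1))) as [A [A0 HA]].
  { apply Rinv_0_lt_compat. assert (B := Rabs_pos M). lra. }
  exists (A + 1); split; [lra|]. intros t Ht HM.
  apply Rnot_lt_le; intros Hlt.
  specialize (HA (t m) ltac:(lra)).
  assert (E : polyv (S m) (fun k => if Nat.eq_dec k m then 1 else 0) (t m) = t m ^ m).
  { unfold polyv; simpl. rewrite rsum_0.
    - destruct (Nat.eq_dec m m); [ring|lia].
    - intros i Hi; destruct (Nat.eq_dec i m); [lia|ring]. }
  rewrite E in HA.
  assert (L := leading_term m t M m Ht HM (le_n _)).
  assert (P : Rabs (rprod (fun j => t m - t (skip m j)) m) <= t m ^ m).
  { apply Rabs_rprod_le; [lra|]. intros j Hj.
    assert (S1 := skip_lt m j m ltac:(lia) Hj).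
    assert (B := node_le_last m t (skip m j) Ht ltac:(lia)).
    rewrite Rabs_pos_eq; lra. }
  rewrite Rabs_pos_eq in HA.
  2:{ apply Rmult_le_pos; [apply Rlt_le, exp_pos|apply pow_le; lra]. }
  assert (X := exp_pos (- t m)). assert (Y := exp_pos (t m)).
  assert (Z : exp (t m) * exp (- t m) = 1).
  { rewrite <- exp_plus, Rplus_opp_r. apply exp_0. }
  assert (P0 := Rabs_pos (rprod (fun j => t m - t (skip m j)) m)).
  assert (MM := Rle_abs M).
  assert (L' : exp (t m) <= (Rabs M + 1) * t m ^ m).
  { eapply Rle_trans; [exact L|].
    apply Rle_trans with ((Rabs M + 1) * Rabs (rprod (fun j => t m - t (skip m j)) m)).
    - apply Rmult_le_compat_r; lra.
    - apply Rmult_le_compat_l; [assert (B := Rabs_pos M); lra|exact P]. }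
  apply (Rmult_le_compat_r (exp (- t m))) in L'; [|lra]. rewrite Z in L'.
  assert (B := Rabs_pos M).
  apply (Rmult_lt_compat_l (Rabs M + 1)) in HA; [|lra].
  rewrite Rinv_r in HA by lra. lra.
Qed.

Lemma leading_minimizer m :
  exists t, nodes (S m) t /\ forall t', nodes (S m) t' -> leading m t <= leading m t'.
Proof.
  set (E := fun y => exists t, nodes (S m) t /\ y = - leading m t).
  assert (L0 : forall t, 0 <= leading m t).
  { intros t. unfold leading. rewrite <- (rsum_0 (fun _ => 0) (S m)) by auto.
    apply rsum_le. intros; apply Rmult_le_pos; [apply Rlt_le, exp_pos|apply Rabs_pos]. }
  destruct (completeness E) as [y0 [Hub Hlub]].
  { exists 0. intros y [t [_ ->]]. specialize (L0 t). lra. }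
  (* The nodes [0, 1, 2, ...] show that [E] is inhabited; [- y0] is the infimum of [leading]. *)
  { exists (- leading m INR), INR; split; [|reflexivity].
    split; [reflexivity|]. intros j _. rewrite S_INR; lra. }
  assert (seq : forall k, exists t, nodes (S m) t /\ leading m t < - y0 + / INR (S k)).
  { intros k. apply NNPP; intros Hno.
    assert (P : 0 < / INR (S k)) by (apply Rinv_0_lt_compat, lt_0_INR; lia).
    enough (y0 <= y0 - / INR (S k)) by lra.
    apply Hlub. intros y [t [Ht ->]].
    apply Rnot_lt_le; intros Hlt. apply Hno. exists t; split; [exact Ht|lra]. }
  set (x := fun k => proj1_sig (constructive_indefinite_description _ (seq k))).
  assert (Hx : forall k, nodes (S m) (x k) /\ leading m (x k) < - y0 + / INR (S k)).
  { intros k. unfold x. now destruct (constructive_indefinite_description _ (seq k)). }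
  set (M := - y0 + 1).
  assert (HM : forall k, leading m (x k) <= M).
  { intros k. destruct (Hx k) as [_ B]. unfold M.
    assert (/ INR (S k) <= 1).
    { rewrite <- Rinv_1. apply Rinv_le_contravar; [lra|]. rewrite S_INR.
      assert (C := pos_INR k). lra. }
    lra. }
  destruct (leading_coercive m M) as [A [A1 HA]].
  assert (xb : forall k i, (i <= m)%nat -> 0 <= x k i <= A).
  { intros k i Hi. destruct (Hx k) as [B _].
    assert (C := node_le_last m (x k) i B Hi). specialize (HA (x k) B (HM k)). lra. }
  destruct (bolzano_weierstrass_vec (S m) x A) as [phi [t [Hphi Ht]]].
  { intros k i Hi. specialize (xb k i ltac:(lia)). rewrite Rabs_pos_eq; lra. }
  assert (M0 : 0 < M).
  { specialize (L0 (x O)). assert (B := HM O). assert (C := leading_term m (x O) M O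
      (proj1 (Hx O)) B ltac:(lia)).
    assert (X := exp_pos (x O O)). assert (Y := Rabs_pos (rprod (fun j => x O O - x O (skip 0 j)) m)).
    nra. }
  assert (Am : 0 < A ^ m) by (apply pow_lt; lra).
  (* In the product of distances from [x k i] one factor is the gap and the others are at most [A],
     so the gap is bounded below uniformly in [k] and the limit nodes stay distinct. *)
  assert (gap : forall k i, (S i <= m)%nat -> / (M * A ^ m) <= x k (S i) - x k i).
  { intros k i Hi. destruct (Hx k) as [B _].
    assert (C := leading_term m (x k) M i B (HM k) ltac:(lia)).
    assert (D := Rabs_rprod_le_factor (fun j => x k i - x k (skip i j)) m A i A1).
    assert (E1 : skip i i = S i).
    { unfold skip; destruct (Nat.ltb_spec i i); [lia|reflexivity]. }
    cbv beta in D. rewrite E1 in D.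
    assert (inc : x k i < x k (S i)) by (apply B; lia).
    rewrite (Rabs_minus_sym (x k i) (x k (S i))), (Rabs_pos_eq (x k (S i) - x k i)) in D by lra.
    assert (D' : Rabs (rprod (fun j => x k i - x k (skip i j)) m)
      <= (x k (S i) - x k i) * A ^ m).
    { apply D; [|lia]. intros j Hj. assert (S1 := skip_lt i j m ltac:(lia) Hj).
      assert (b1 := xb k i ltac:(lia)). assert (b2 := xb k (skip i j) ltac:(lia)).
      apply Rabs_le; lra. }
    assert (e1 : 1 <= exp (x k i)).
    { assert (e := exp_ineq1_le (x k i)). specialize (xb k i ltac:(lia)). lra. }
    apply (Rmult_le_reg_l (M * A ^ m)); [apply Rmult_lt_0_compat; lra|].
    rewrite Rinv_r by (apply Rgt_not_eq, Rmult_lt_0_compat; lra).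
    apply (Rmult_le_compat_l M) in D'; [|lra]. lra. }
  assert (Hnodes : nodes (S m) t).
  { split.
    - assert (B := Ht O ltac:(lia)).
      assert (C : is_lim_seq (fun k => x (phi k) O) (Finite 0)).
      { apply (is_lim_seq_ext (fun _ => 0)); [|apply is_lim_seq_const].
        intros k. symmetry. apply (Hx (phi k)). }
      apply is_lim_seq_unique in B. apply is_lim_seq_unique in C.
      rewrite B in C. now injection C.
    - intros i Hi.
      assert (B : Rbar_le (Finite (/ (M * A ^ m))) (Finite (t (S i) - t i))).
      { apply (is_lim_seq_le (fun _ => / (M * A ^ m))
          (fun k => x (phi k) (S i) - x (phi k) i)).
        - intros k; apply gap; lia.
        - apply is_lim_seq_const.
        - apply is_lim_seq_minus'; apply Ht; lia. }
      simpl in B. assert (0 < / (M * A ^ m)); [|lra].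
      apply Rinv_0_lt_compat, Rmult_lt_0_compat; lra. }
  exists t; split; [exact Hnodes|]. intros t' Ht'.
  assert (B : - leading m t' <= y0) by (apply Hub; exists t'; auto).
  enough (C : Rbar_le (Finite (leading m t)) (Finite (- y0))) by (simpl in C; lra).
  apply (is_lim_seq_le (fun k => leading m (x (phi k))) (fun k => - y0 + / INR (S (phi k)))).
  - intros k. apply Rlt_le, Hx.
  - apply leading_continuous; [now apply nodes_distinct|].
    intros i Hi; apply Ht; lia.
  - replace (Finite (- y0)) with (Finite (- y0 + 0)) by (f_equal; ring).
    apply is_lim_seq_plus'; [apply is_lim_seq_const|].
    apply (is_lim_seq_subseq (fun k => / INR (S k))); [now apply eventually_subseq|].
    apply (is_lim_seq_inv (fun k => INR (S k)) p_infty); [|discriminate].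
    apply (is_lim_seq_incr_1 INR), is_lim_seq_INR.
Qed.

Lemma derive_neq0_increase (f : R -> R) x d rho :
  is_derive f x d -> d <> 0 -> 0 < rho ->
  exists z, Rabs (z - x) < rho /\ f x < f z.
Proof.
  intros Hf Hd Hr. apply is_derive_Reals in Hf.
  destruct (Hf (Rabs d / 2)) as [del Hdel].
  { assert (A := Rabs_pos_lt d Hd). lra. }
  set (r := Rmin rho (del / 2) / 2).
  assert (r0 : 0 < r /\ r < rho /\ r < del).
  { assert (A := cond_pos del). assert (M1 := Rmin_l rho (del / 2)).
    assert (M2 := Rmin_r rho (del / 2)).
    assert (0 < Rmin rho (del / 2)) by (apply Rmin_glb_lt; lra). unfold r. lra. }
  set (h := if Rlt_dec 0 d then r else - r).
  assert (Hh : Rabs h = r /\ h <> 0).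
  { unfold h. destruct (Rlt_dec 0 d).
    - rewrite Rabs_pos_eq; lra.
    - rewrite Rabs_Ropp, Rabs_pos_eq; lra. }
  exists (x + h). replace (x + h - x) with h by ring. split; [lra|].
  assert (B := Hdel h (proj2 Hh) ltac:(lra)).
  apply Rabs_def2 in B.
  assert (Q : (f (x + h) - f x) = (f (x + h) - f x) / h * h) by (field; apply Hh).
  set (q := (f (x + h) - f x) / h) in *.
  assert (0 < q * h); [|lra].
  unfold h in *. destruct (Rlt_dec 0 d).
  - rewrite (Rabs_pos_eq d) in B by lra. nra.
  - rewrite (Rabs_left d) in B by lra. nra.
Qed.

(** Minimality of [leading] makes every positive node a critical point of the interpolating function
    [Q]. Since [Q'] is [exp (- x)] times a polynomial of degree [m], these are all its zeros, which
    leaves no room for a larger extremum. *)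
Lemma chebR_exists n : (2 <= n)%nat -> exists c, is_chebR n c.
Proof.
  intros Hn. destruct n as [|m]; [lia|].
  destruct (leading_minimizer m) as [t [Ht Hmin]].
  destruct (polyv_interpolation m t (fun i => (-1) ^ i * exp (t i)) (nodes_distinct m t Ht))
    as [c Hc].
  set (Q := fun t => exp (- t) * polyv (S m) c t).
  assert (Hv : forall i, (i <= m)%nat -> Q (t i) = (-1) ^ i).
  { intros i Hi. unfold Q. rewrite Hc by exact Hi.
    replace (exp (- t i) * ((-1) ^ i * exp (t i))) with ((-1) ^ i * (exp (- t i) * exp (t i))) by ring.
    rewrite <- exp_plus, Rplus_opp_l, exp_0. ring. }
  assert (lead : (-1) ^ m * c m = leading m t).
  { rewrite (leading_polyv m t) by exact Ht. apply rsum_ext. intros i Hi.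
    rewrite Hc by lia. rewrite <- Rmult_assoc, sign_sqr. ring. }
  set (dQ := fun x => exp (- x) * (polyv m (fun k => INR (S k) * c (S k)) x - polyv (S m) c x)).
  assert (HdQ : forall x, is_derive Q x (dQ x)) by (intros; apply is_derive_laguerre).
  assert (crit : forall k, (0 < k <= m)%nat -> dQ (t k) = 0).
  { intros k Hk. apply NNPP; intros Hne.
    assert (below : t (pred k) < t k).
    { apply (increasing_lt t (S m)); [apply Ht|lia]. }
    (* A displacement below [rho] keeps the nodes ordered; the last node has no right neighbour, and
       1 is an arbitrary allowance. *)
    set (rho := Rmin (t k - t (pred k)) (if Nat.eq_dec k m then 1 else t (S k) - t k)).
    assert (rho0 : 0 < rho).
    { unfold rho. apply Rmin_glb_lt; [lra|].
      destruct (Nat.eq_dec k m); [lra|]. assert (t k < t (S k)) by (apply Ht; lia). lra. }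
    destruct (derive_neq0_increase (fun x => (-1) ^ k * Q x) (t k) ((-1) ^ k * dQ (t k)) rho)
      as [z [Hz Hinc]].
    - apply is_derive_scal, HdQ.
    - apply Rmult_integral_contrapositive; split; [apply pow_nonzero; lra|exact Hne].
    - exact rho0.
    - rewrite Hv, sign_sqr in Hinc by lia.
      assert (R1 : rho <= t k - t (pred k)) by apply Rmin_l.
      assert (R2 : rho <= if Nat.eq_dec k m then 1 else t (S k) - t k) by apply Rmin_r.
      apply Rabs_def2 in Hz.
      set (t' := fun j => if Nat.eq_dec j k then z else t j).
      assert (Ht' : nodes (S m) t').
      { split; unfold t'.
        - destruct (Nat.eq_dec 0 k); [lia|apply Ht].
        - intros j Hj. destruct (Nat.eq_dec j k) as [E|], (Nat.eq_dec (S j) k) as [E'|];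
            try lia.
          + subst j. destruct (Nat.eq_dec k m); [lia|lra].
          + assert (j = pred k) by lia. subst j. lra.
          + apply Ht; lia. }
      (* At the moved nodes [c] still has alternating values, with excess at [z], so [leading m t']
         is smaller than [(-1)^m * c m = leading m t]. *)
      assert (L := Hmin t' Ht'). rewrite <- lead, (leading_polyv m t' c Ht') in L.
      unfold leading in L. apply Rle_not_lt in L; apply L. clear L.
      assert (pos : forall i, (i <= m)%nat -> 0 < Rabs (divdiff t' m i)).
      { intros i Hi. apply Rabs_pos_lt, Rinv_neq_0_compat, distinct_rprod; [|exact Hi].
        now apply nodes_distinct. }
      assert (val : exp z < (-1) ^ k * polyv (S m) c z).
      { unfold Q in Hinc. assert (Z := exp_pos z).
        apply (Rmult_lt_compat_l (exp z)) in Hinc; [|exact Z].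
        replace (exp z * ((-1) ^ k * (exp (- z) * polyv (S m) c z)))
          with (exp z * exp (- z) * ((-1) ^ k * polyv (S m) c z)) in Hinc by ring.
        rewrite <- exp_plus, Rplus_opp_r, exp_0 in Hinc. lra. }
      apply rsum_lt with k; [lia| |].
      + intros j Hj. specialize (pos j ltac:(lia)).
        apply Rmult_le_compat_r; [lra|]. unfold t'.
        destruct (Nat.eq_dec j k) as [->|]; [lra|].
        rewrite Hc by lia. rewrite <- Rmult_assoc, sign_sqr. lra.
      + specialize (pos k ltac:(lia)). apply Rmult_lt_compat_r; [exact pos|].
        unfold t'. destruct (Nat.eq_dec k k); [exact val|lia]. }
  assert (leadpos : 0 < leading m t).
  { unfold leading.
    apply Rlt_le_trans with (exp (t O) * Rabs (divdiff t m O)).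
    - apply Rmult_lt_0_compat; [apply exp_pos|].
      apply Rabs_pos_lt, Rinv_neq_0_compat, distinct_rprod; [now apply nodes_distinct|lia].
    - apply (rsum_ge_term (fun i => exp (t i) * Rabs (divdiff t m i)) (S m) O); [lia|].
      intros j _; apply Rmult_le_pos; [apply Rlt_le, exp_pos|apply Rabs_pos]. }
  assert (cm : c m <> 0) by (intros E; rewrite E in lead; lra).
  assert (Q0 : Rabs (Q 0) = 1).
  { rewrite <- (proj1 Ht), Hv, Rabs_sign by lia. reflexivity. }
  assert (bound : forall s, 0 <= s -> Rabs (Q s) <= 1).
  { intros s Hs. apply Rnot_lt_le; intros Hlt.
    destruct (vanishing_extremum Q dQ s HdQ) as [X [X0 [D L]]];
      [apply vanishing_laguerre|exact Hs|lra|].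
    (* Replacing the node 0 by [X] gives [m + 1] distinct zeros of [Q'], in no particular order. The
       divided difference then forces its top coefficient, [- c m], to vanish. *)
    set (t' := fun j => if Nat.eq_dec j 0 then X else t j).
    assert (dist : distinct m t').
    { assert (aux : forall j, (0 < j <= m)%nat -> X <> t j).
      { intros j Hj E. rewrite E, Hv, Rabs_sign in L by lia. lra. }
      intros i j Hi Hj Hij. unfold t'.
      destruct (Nat.eq_dec i 0), (Nat.eq_dec j 0); try lia.
      - apply aux; lia.
      - apply not_eq_sym, aux; lia.
      - now apply (nodes_distinct m t Ht). }
    set (d := fun k => (if Nat.eq_dec k m then 0 else INR (S k) * c (S k)) - c k).
    assert (Hd : forall x, dQ x = exp (- x) * polyv (S m) d x).
    { intros x. unfold dQ. f_equal. unfold polyv, d. cbn [rsum].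
      destruct (Nat.eq_dec m m); [|lia].
      rewrite (rsum_ext (fun k => ((if Nat.eq_dec k m then 0 else INR (S k) * c (S k)) - c k) * x ^ k)
        (fun k => INR (S k) * c (S k) * x ^ k - c k * x ^ k)).
      - rewrite rsum_minus. ring.
      - intros i Hi. destruct (Nat.eq_dec i m); [lia|ring]. }
    assert (Z := divdiff_polyv m t' d dist).
    rewrite rsum_0 in Z.
    - unfold d in Z. destruct (Nat.eq_dec m m); [|lia]. apply cm. lra.
    - intros i Hi. assert (W : dQ (t' i) = 0).
      { unfold t'. destruct (Nat.eq_dec i 0); [exact D|]. apply crit; lia. }
      rewrite Hd in W. apply Rmult_integral in W. destruct W as [W|W].
      + assert (P := exp_pos (- t' i)). lra.
      + rewrite W; ring. }
  exists c. unfold is_chebR. replace (S m - 1)%nat with m by lia. split; [exact cm|split].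
  - apply Rle_antisym; [now apply supnorm_le|].
    fold Q. rewrite <- Q0. apply (le_supnorm Q 1); [exact bound|lra].
  - exists t, 1. split; [now left|split; [apply Ht|split; [apply Ht|]]].
    intros i Hi. fold (Q (t i)). rewrite Hv by lia. ring.
Qed.

(** * Binomial coefficients *)

Lemma binom_n_0 m : binom m 0 = 1%nat.
Proof. now destruct m. Qed.

Lemma binom_S_S m k : binom (S m) (S k) = (binom m k + binom m (S k))%nat.
Proof. reflexivity. Qed.

Lemma binom_gt m : forall k, (m < k)%nat -> binom m k = 0%nat.
Proof.
  induction m as [|m IH]; intros [|k] H; try lia; [reflexivity|].
  rewrite binom_S_S, !IH by lia. reflexivity.
Qed.

Lemma binom_pos m : forall k, (k <= m)%nat -> (0 < binom m k)%nat.
Proof.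
  induction m as [|m IH]; intros [|k] H; try (rewrite binom_n_0; lia); [lia|].
  rewrite binom_S_S. specialize (IH k ltac:(lia)). lia.
Qed.

Lemma binom_absorb m : forall k, (S k * binom (S m) (S k) = S m * binom m k)%nat.
Proof.
  induction m as [|m IH]; intros k.
  - destruct k; rewrite binom_S_S; simpl; lia.
  - rewrite (binom_S_S (S m)). destruct k as [|k].
    + specialize (IH O). rewrite !binom_n_0 in *. lia.
    + assert (A := IH k). assert (B := IH (S k)).
      assert (E := binom_S_S m k). nia.
Qed.

Lemma binom_absorb_up m k :
  (INR (S m) - INR k) * INR (binom (S m) k) = INR (S m) * INR (binom m k).
Proof.
  destruct k as [|k]; [rewrite !binom_n_0; simpl INR; ring|].
  assert (A := f_equal INR (binom_absorb m k)). rewrite !mult_INR in A.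
  assert (B := f_equal INR (binom_S_S m k)). rewrite plus_INR in B.
  replace (INR (binom m (S k))) with (INR (binom (S m) (S k)) - INR (binom m k)) by lra.
  lra.
Qed.

Lemma central_binom_S k :
  INR (S k) * INR (binom (2 * S k) (S k)) = 2 * (2 * INR k + 1) * INR (binom (2 * k) k).
Proof.
  replace (2 * S k)%nat with (S (S (2 * k))) by lia.
  assert (A := f_equal INR (binom_absorb (S (2 * k)) k)). rewrite !mult_INR in A.
  assert (B := binom_absorb_up (2 * k) k).
  rewrite !S_INR, !mult_INR in *. replace (INR 2) with 2 in * by (simpl; lra). lra.
Qed.

Lemma central_binom_pos k : 0 < INR (binom (2 * k) k).
Proof. apply lt_0_INR, binom_pos; lia. Qed.

(** * Laguerre polynomials of parameters -1/2 and 1/2 *)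

(** Coefficients of the Laguerre polynomial [L_m^(-1/2) (2 t)] normalised to 1 at 0. The [8^k] and
    the central binomial come from [2^k] and the rising factorial [(1/2)_k = (2k)! / (4^k k!)]; for
    parameter 1/2 the latter gains the factor [2 k + 1]. *)
Definition hq (m k : nat) : R :=
  (-1) ^ k * 8 ^ k * INR (binom m k) / (INR (binom (2 * k) k) * INR (fact k)).

Definition hs (m k : nat) : R := hq m k / (2 * INR k + 1).

(* [Hq m (x^2 / 2)] is proportional to the Hermite polynomial [H_{2m}(x)],
   and [x * Hs m (x^2 / 2)] to [H_{2m+1}(x)]. *)
Definition Hq (m : nat) : R -> R := polyv (S m) (hq m).
Definition Hs (m : nat) : R -> R := polyv (S m) (hs m).
Definition Hs' (m : nat) : R -> R := polyv m (fun k => INR (S k) * hs m (S k)).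

Lemma two_INR_pos k : 0 < 2 * INR k + 1.
Proof. assert (A := pos_INR k). lra. Qed.

Lemma hq_0 m : hq m 0 = 1.
Proof. unfold hq. rewrite !binom_n_0. simpl. field. Qed.

Lemma hq_gt m k : (m < k)%nat -> hq m k = 0.
Proof. intros H. unfold hq. rewrite binom_gt by exact H. simpl INR. unfold Rdiv; ring. Qed.

Lemma hs_gt m k : (m < k)%nat -> hs m k = 0.
Proof. intros H. unfold hs. rewrite hq_gt by exact H. unfold Rdiv; ring. Qed.

(** The left side is [hq m (S k)] with [binom m k] in place of [binom m (S k)]. Pascal's rule turns
    this identity into a recurrence in [m], and absorption turns it into a derivative formula. *)
Lemma hq_hs_shift m k :
  (-1) ^ S k * 8 ^ S k * INR (binom m k) / (INR (binom (2 * S k) (S k)) * INR (fact (S k)))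
  = - 4 * hs m k.
Proof.
  unfold hs, hq. assert (A := central_binom_S k).
  assert (P1 := central_binom_pos k). assert (P2 := central_binom_pos (S k)).
  assert (P3 := two_INR_pos k). assert (P4 := INR_fact_lt_0 k).
  assert (P5 : 0 < INR (S k)) by (apply lt_0_INR; lia).
  rewrite fact_simpl, mult_INR.
  set (B := INR (binom (2 * k) k)) in *. set (B' := INR (binom (2 * S k) (S k))) in *.
  replace (B' * (INR (S k) * INR (fact k))) with (2 * (2 * INR k + 1) * B * INR (fact k))
    by (rewrite <- A; ring).
  simpl pow. field. repeat split; lra.
Qed.

Lemma hq_step m k : hq (S m) (S k) = hq m (S k) - 4 * hs m k.
Proof.
  unfold Rminus. replace (- (4 * hs m k)) with (- 4 * hs m k) by ring.
  rewrite <- hq_hs_shift. unfold hq. rewrite binom_S_S, plus_INR.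
  unfold Rdiv. ring.
Qed.

Lemma hq_derive m k : INR (S k) * hq (S m) (S k) = - 4 * INR (S m) * hs m k.
Proof.
  replace (- 4 * INR (S m) * hs m k) with (INR (S m) * (- 4 * hs m k)) by ring.
  rewrite <- hq_hs_shift. unfold hq.
  assert (A := f_equal INR (binom_absorb m k)). rewrite !mult_INR in A.
  unfold Rdiv. rewrite <- !Rmult_assoc.
  replace (INR (S k) * (-1) ^ S k * 8 ^ S k * INR (binom (S m) (S k)))
    with ((-1) ^ S k * 8 ^ S k * (INR (S k) * INR (binom (S m) (S k)))) by ring.
  rewrite A. ring.
Qed.

Lemma hs_step m k : (2 * INR (S m) + 1) * hs (S m) k = hq (S m) k + 2 * INR (S m) * hs m k.
Proof.
  unfold hs, hq. assert (A := binom_absorb_up m k).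
  assert (P1 := central_binom_pos k). assert (P3 := two_INR_pos k).
  assert (P4 := INR_fact_lt_0 k).
  replace (2 * INR (S m) *
    ((-1) ^ k * 8 ^ k * INR (binom m k) / (INR (binom (2 * k) k) * INR (fact k)) / (2 * INR k + 1)))
    with ((-1) ^ k * 8 ^ k * 2 * (INR (S m) * INR (binom m k))
      / (INR (binom (2 * k) k) * INR (fact k)) / (2 * INR k + 1)) by (field; lra).
  rewrite <- A. field. lra.
Qed.

Lemma polyv_S n c t : polyv (S n) c t = polyv n c t + c n * t ^ n.
Proof. reflexivity. Qed.

Lemma Hq_step m t : Hq (S m) t = Hq m t - 4 * t * Hs m t.
Proof.
  assert (E : Hq m t = polyv (S (S m)) (hq m) t).
  { unfold Hq. rewrite (polyv_S (S m)), (hq_gt m (S m)) by lia. ring. }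
  rewrite E. unfold Hq, Hs, polyv. rewrite !(rsum_S_l _ (S m)), !hq_0.
  rewrite (rsum_ext (fun i => hq (S m) (S i) * t ^ S i)
    (fun i => hq m (S i) * t ^ S i - 4 * t * (hs m i * t ^ i))).
  2:{ intros i _; rewrite hq_step; simpl; ring. }
  rewrite rsum_minus, rsum_scal. ring.
Qed.

Lemma is_derive_Hq_S m t : is_derive (Hq (S m)) t (- 4 * INR (S m) * Hs m t).
Proof.
  replace (- 4 * INR (S m) * Hs m t)
    with (polyv (S m) (fun k => INR (S k) * hq (S m) (S k)) t); [apply is_derive_polyv|].
  unfold Hs, polyv. rewrite <- rsum_scal. apply rsum_ext; intros i _.
  rewrite hq_derive. ring.
Qed.

Lemma is_derive_Hs m t : is_derive (Hs m) t (Hs' m t).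
Proof. apply is_derive_polyv. Qed.

(** With [t = x^2 / 2] this says that [x * Hs m (x^2 / 2)] has derivative [Hq m (x^2 / 2)]: the
    derivative of [H_{2m+1}] is proportional to [H_{2m}]. *)
Lemma Hs_Hq m t : Hs m t + 2 * t * Hs' m t = Hq m t.
Proof.
  unfold Hs, Hs', Hq, polyv.
  rewrite (rsum_ext (fun k => hq m k * t ^ k) (fun k => hs m k * t ^ k + 2 * (INR k * (hs m k * t ^ k)))).
  2:{ intros k _. unfold hs. assert (P3 := two_INR_pos k). field. lra. }
  rewrite rsum_plus, rsum_scal. f_equal.
  rewrite (rsum_S_l (fun k => INR k * _)). change (INR 0) with 0.
  rewrite Rmult_assoc. f_equal. rewrite <- rsum_scal.
  rewrite Rmult_0_l, Rplus_0_l. apply rsum_ext; intros; simpl pow; ring.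
Qed.

Lemma Hs_step m t : (2 * INR (S m) + 1) * Hs (S m) t = Hq (S m) t + 2 * INR (S m) * Hs m t.
Proof.
  assert (E : Hs m t = polyv (S (S m)) (hs m) t).
  { unfold Hs. rewrite (polyv_S (S m)), (hs_gt m (S m)) by lia. ring. }
  rewrite E. unfold Hq, Hs, polyv. rewrite <- !rsum_scal, <- rsum_plus.
  apply rsum_ext; intros i _. rewrite <- Rmult_assoc, hs_step. ring.
Qed.

Lemma Hq_at_0 m : Hq m 0 = 1.
Proof.
  unfold Hq, polyv. rewrite rsum_S_l, hq_0, rsum_0; [simpl; ring|].
  intros; simpl; ring.
Qed.

(** * Sign changes of the Hermite polynomials *)

(** By Rodrigues' formula [gaussq] and [gausss] are, up to constants, the even and odd derivatives
    of [exp (- x^2)]; differentiating repeatedly creates the sign changes. *)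
Definition gaussq (m : nat) (x : R) : R := exp (- (x * x)) * Hq m (x * x / 2).
Definition gausss (m : nat) (x : R) : R := x * exp (- (x * x)) * Hs m (x * x / 2).

Lemma is_derive_half_sqr (f : R -> R) x d :
  is_derive f (x * x / 2) d -> is_derive (fun x => f (x * x / 2)) x (x * d).
Proof.
  intros H. apply (is_derive_comp f (fun x => x * x / 2)); [exact H|].
  auto_derive; [auto|field].
Qed.

Lemma is_derive_gaussq m x :
  is_derive (gaussq m) x (- 2 * (2 * INR m + 1) * gausss m x).
Proof.
  unfold gaussq, gausss. destruct m as [|m].
  - apply (is_derive_ext (fun x => exp (- (x * x)))).
    + intros t. unfold Hq, polyv; simpl. rewrite hq_0. ring.
    + auto_derive; [auto|]. unfold Hs, polyv, hs; simpl. rewrite hq_0. field.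
  - replace (- 2 * (2 * INR (S m) + 1) * (x * exp (- (x * x)) * Hs (S m) (x * x / 2)))
      with (- 2 * x * exp (- (x * x)) * Hq (S m) (x * x / 2)
        + exp (- (x * x)) * (x * (- 4 * INR (S m) * Hs m (x * x / 2)))).
    + apply (is_derive_mult (fun x => exp (- (x * x))) (fun x => Hq (S m) (x * x / 2)));
        [|apply is_derive_half_sqr, is_derive_Hq_S|intros; apply Rmult_comm].
      auto_derive; [auto|ring].
    + assert (A := Hs_step m (x * x / 2)).
      replace (- 2 * (2 * INR (S m) + 1) * (x * exp (- (x * x)) * Hs (S m) (x * x / 2)))
        with (- 2 * x * exp (- (x * x)) * ((2 * INR (S m) + 1) * Hs (S m) (x * x / 2))) by ring.
      rewrite A. ring.
Qed.

Lemma is_derive_gausss m x : is_derive (gausss m) x (gaussq (S m) x).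
Proof.
  unfold gaussq, gausss.
  replace (exp (- (x * x)) * Hq (S m) (x * x / 2))
    with ((exp (- (x * x)) - 2 * (x * x) * exp (- (x * x))) * Hs m (x * x / 2)
      + x * exp (- (x * x)) * (x * Hs' m (x * x / 2))).
  - apply (is_derive_mult (fun x => x * exp (- (x * x))) (fun x => Hs m (x * x / 2)));
      [|apply is_derive_half_sqr, is_derive_Hs|intros; apply Rmult_comm].
    auto_derive; [auto|ring].
  - rewrite Hq_step, <- Hs_Hq. field.
Qed.

Lemma vanishing_half_sqr g : vanishing g -> vanishing (fun x => g (x * x / 2)).
Proof.
  intros H eta He. destruct (H eta He) as [A [A0 HA]].
  exists (A + 2); split; [lra|]. intros x Hx. apply HA. nra.
Qed.

Lemma vanishing_dominated f g :
  (forall x, 0 <= x -> Rabs (f x) <= Rabs (g x)) -> vanishing g -> vanishing f.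
Proof.
  intros Hfg H eta He. destruct (H eta He) as [A [A0 HA]].
  exists A; split; [exact A0|]. intros x Hx.
  eapply Rle_lt_trans; [apply Hfg; lra|now apply HA].
Qed.

Lemma vanishing_gaussq m : vanishing (gaussq m).
Proof.
  apply (vanishing_dominated _ (fun x => exp (- (x * x / 2)) * Hq m (x * x / 2))).
  - intros x Hx. unfold gaussq. rewrite !Rabs_mult.
    apply Rmult_le_compat_r; [apply Rabs_pos|].
    rewrite !Rabs_pos_eq by (apply Rlt_le, exp_pos).
    destruct (Req_dec x 0) as [->|].
    + right; f_equal; field.
    + left; apply exp_increasing. nra.
  - apply (vanishing_half_sqr (fun t => exp (- t) * Hq m t)), vanishing_laguerre.
Qed.

Lemma vanishing_gausss m : vanishing (gausss m).
Proof.
  apply (vanishing_dominated _ (fun x => exp (- (x * x / 2)) * Hs m (x * x / 2))).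
  - intros x Hx. unfold gausss. rewrite !Rabs_mult.
    apply Rmult_le_compat_r; [apply Rabs_pos|].
    rewrite !(Rabs_pos_eq (exp _)) by (apply Rlt_le, exp_pos).
    rewrite Rabs_pos_eq by exact Hx.
    replace (- (x * x)) with (- (x * x / 2) + - (x * x / 2)) by field.
    rewrite exp_plus, <- Rmult_assoc.
    assert (P := exp_pos (- (x * x / 2))).
    assert (A : x <= exp (x * x / 2)).
    { assert (B := exp_ineq1_le (x * x / 2)). nra. }
    assert (B : x * exp (- (x * x / 2)) <= 1).
    { apply (Rmult_le_compat_r (exp (- (x * x / 2)))) in A; [|lra].
      rewrite <- exp_plus, Rplus_opp_r, exp_0 in A. exact A. }
    nra.
  - apply (vanishing_half_sqr (fun t => exp (- t) * Hs m t)), vanishing_laguerre.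
Qed.

(** Decay supplies one more point [E], where [|f|] is below [|f (u M)|], so the derivative
    alternates at as many points as [f]. The sign at [u 0] may be weak, so that the zero at 0 of an
    odd function can serve as first point. *)
Lemma rolle_vanishing (f f' : R -> R) (u : nat -> R) M :
  (forall x, is_derive f x (f' x)) -> vanishing f -> 0 <= u O ->
  (forall i, (i < M)%nat -> u i < u (S i)) ->
  (forall i, (i <= M)%nat -> 0 <= (-1) ^ i * f (u i)) ->
  (forall i, (0 < i <= M)%nat -> 0 < (-1) ^ i * f (u i)) ->
  0 < (-1) ^ M * f (u M) ->
  exists v, 0 < v O /\ (forall i, (i < M)%nat -> v i < v (S i)) /\
    forall i, (i <= M)%nat -> 0 < (-1) ^ S i * f' (v i).
Proof.
  intros Hf Hv H0 Hu Hw Hs HM.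
  assert (Ab : forall i x, - Rabs (f x) <= (-1) ^ i * f x <= Rabs (f x)).
  { intros i x. apply Rabs_le_between. rewrite Rabs_mult, Rabs_sign. lra. }
  destruct (Hv ((-1) ^ M * f (u M)) HM) as [A [A0 HA]].
  set (E := Rmax A (u M + 1)).
  assert (E1 : A <= E) by apply Rmax_l. assert (E2 : u M + 1 <= E) by apply Rmax_r.
  set (u' := fun i => if Nat.eq_dec i (S M) then E else u i).
  destruct (finite_choice (fun i v => u' i < v < u' (S i) /\ 0 < (-1) ^ S i * f' v) 0 (S M))
    as [v V].
  - intros i Hi.
    assert (L : u' i < u' (S i)).
    { unfold u'. destruct (Nat.eq_dec i (S M)) as [e0|], (Nat.eq_dec (S i) (S M)) as [e|]; try lia.
      - injection e as ->. lra.
      - apply Hu; lia. }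
    destruct (MVT_is_derive f f' (u' i) (u' (S i)) L) as [c [Ec Hc]]; [intros; apply Hf|].
    exists c; split; [exact Hc|].
    assert (D : 0 < (-1) ^ S i * (f (u' (S i)) - f (u' i))).
    { unfold u'. destruct (Nat.eq_dec i (S M)) as [e0|], (Nat.eq_dec (S i) (S M)) as [e|]; try lia.
      - injection e as ->. specialize (HA E E1). assert (B := Ab M E).
        simpl pow. lra.
      - assert (B1 := Hw i ltac:(lia)). assert (B2 := Hs (S i) ltac:(lia)).
        simpl pow in *. lra. }
    rewrite Ec in D. apply (Rmult_lt_reg_r (u' (S i) - u' i)); lra.
  - exists v. repeat split.
    + assert (B := V O ltac:(lia)). unfold u' in B.
      destruct (Nat.eq_dec 0 (S M)); [lia|]. lra.
    + intros i Hi. assert (B1 := V i ltac:(lia)). assert (B2 := V (S i) ltac:(lia)). lra.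
    + intros i Hi. apply V; lia.
Qed.

Lemma Hq_alternates m :
  exists u, 0 <= u O /\ (forall i, (i < m)%nat -> u i < u (S i)) /\
    forall i, (i <= m)%nat -> 0 < (-1) ^ i * Hq m (u i * u i / 2).
Proof.
  induction m as [|m IH].
  - exists (fun _ => 0); repeat split; [lra|intros; lia|].
    intros i Hi. replace i with O by lia. replace (0 * 0 / 2) with 0 by field.
    rewrite Hq_at_0. simpl; lra.
  - destruct IH as [u [U0 [U1 U2]]].
    assert (U3 : forall i, (i <= m)%nat -> 0 < (-1) ^ i * gaussq m (u i)).
    { intros i Hi. unfold gaussq. assert (P := exp_pos (- (u i * u i))).
      specialize (U2 i Hi). nra. }
    destruct (rolle_vanishing _ _ u m (is_derive_gaussq m) (vanishing_gaussq m) U0 U1)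
      as [v [V0 [V1 V2]]].
    + intros i Hi; apply Rlt_le, U3, Hi.
    + intros i Hi; apply U3; lia.
    + apply U3; lia.
    + assert (V3 : forall i, (i <= m)%nat -> 0 < (-1) ^ i * gausss m (v i)).
      { intros i Hi. specialize (V2 i Hi). simpl pow in V2.
        assert (P := two_INR_pos m).
        apply (Rmult_lt_reg_l (2 * (2 * INR m + 1))); [lra|]. lra. }
      (* The odd function [gausss m] vanishes at 0, which gains a point; the factor [-1] compensates
         for the shifted indices. *)
      set (v' := fun i => match i with O => 0 | S j => v j end).
      destruct (rolle_vanishing (fun x => -1 * gausss m x) (fun x => -1 * gaussq (S m) x)
        v' (S m)) as [w [W0 [W1 W2]]].
      * intros x. apply is_derive_scal, is_derive_gausss.
      * apply (vanishing_dominated _ (gausss m)); [|apply vanishing_gausss].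
        intros x _. rewrite Rabs_mult. replace (Rabs (-1)) with 1; [lra|].
        rewrite Rabs_left; lra.
      * simpl; lra.
      * intros [|i] Hi; simpl; [exact V0|apply V1; lia].
      * intros [|i] Hi; simpl.
        -- unfold gausss. right; ring.
        -- specialize (V3 i ltac:(lia)). lra.
      * intros [|i] Hi; [lia|]. simpl. specialize (V3 i ltac:(lia)). lra.
      * simpl. specialize (V3 m (le_n _)). lra.
      * exists w; repeat split; [lra|exact W1|].
        intros i Hi. specialize (W2 i Hi). unfold gaussq in W2. simpl pow in W2.
        assert (P := exp_pos (- (w i * w i))).
        apply (Rmult_lt_reg_l (exp (- (w i * w i)))); [exact P|]. lra.
Qed.

(** * Extrema of the Hermite functions *)

Lemma is_derive_exp_opp t : is_derive (fun t => exp (- t)) t (- exp (- t)).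
Proof. auto_derive; [auto|ring]. Qed.

Definition hermite (m : nat) (x : R) : R := exp (- (x * x / 2)) * Hq m (x * x / 2).
Definition hermite' (m : nat) (x : R) : R :=
  - x * exp (- (x * x / 2)) * (4 * INR m * Hs (pred m) (x * x / 2) + Hq m (x * x / 2)).

Lemma is_derive_Hq m t : is_derive (Hq m) t (- 4 * INR m * Hs (pred m) t).
Proof.
  destruct m as [|m]; [|apply is_derive_Hq_S].
  simpl INR. replace (- 4 * 0 * Hs (pred 0) t) with 0 by ring.
  apply (is_derive_ext (fun _ => 1)); [|apply (is_derive_const 1)].
  intros u. unfold Hq, polyv; simpl. rewrite hq_0. ring.
Qed.

Lemma is_derive_hermite m x : is_derive (hermite m) x (hermite' m x).
Proof.
  unfold hermite, hermite'.
  replace (- x * exp (- (x * x / 2)) * (4 * INR m * Hs (pred m) (x * x / 2) + Hq m (x * x / 2)))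
    with (- x * exp (- (x * x / 2)) * Hq m (x * x / 2)
      + exp (- (x * x / 2)) * (x * (- 4 * INR m * Hs (pred m) (x * x / 2)))) by ring.
  apply (is_derive_mult (fun x => exp (- (x * x / 2))) (fun x => Hq m (x * x / 2)));
    [|apply is_derive_half_sqr, is_derive_Hq|intros; apply Rmult_comm].
  replace (- x * exp (- (x * x / 2))) with (x * (- exp (- (x * x / 2)))) by ring.
  apply (is_derive_half_sqr (fun t => exp (- t))), is_derive_exp_opp.
Qed.

(** Hermite's equation [f'' = (x^2 - (2 d + 1)) f] for the degree [d = 2 m]. *)
Lemma is_derive_hermite' m x :
  is_derive (hermite' m) x ((x * x - (4 * INR m + 1)) * hermite m x).
Proof.
  unfold hermite, hermite'.
  set (t := x * x / 2).
  replace ((x * x - (4 * INR m + 1)) * (exp (- t) * Hq m t))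
    with ((- exp (- t) + x * x * exp (- t)) * (4 * INR m * Hs (pred m) t + Hq m t)
      + - x * exp (- t) * (x * (4 * INR m * Hs' (pred m) t + - 4 * INR m * Hs (pred m) t))).
  - apply (is_derive_mult (fun x => - x * exp (- (x * x / 2)))
      (fun x => 4 * INR m * Hs (pred m) (x * x / 2) + Hq m (x * x / 2)));
      [| |intros; apply Rmult_comm].
    + replace (- exp (- t) + x * x * exp (- t))
        with (-1 * exp (- t) + - x * (x * (- exp (- t)))) by ring.
      apply (is_derive_mult (fun x => - x) (fun x => exp (- (x * x / 2))));
        [auto_derive; [auto|ring]| |intros; apply Rmult_comm].
      apply (is_derive_half_sqr (fun t => exp (- t))), is_derive_exp_opp.
    + unfold t. apply (is_derive_half_sqr (fun t => 4 * INR m * Hs (pred m) t + Hq m t)).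
      apply (is_derive_plus (V := R_NormedModule)
        (fun t => 4 * INR m * Hs (pred m) t) (Hq m)).
      * apply is_derive_scal, is_derive_Hs.
      * apply is_derive_Hq.
  - replace (x * x) with (2 * t) by (unfold t; field).
    replace (- x * exp (- t) * (x * (4 * INR m * Hs' (pred m) t + - 4 * INR m * Hs (pred m) t)))
      with (- (x * x) * exp (- t) * (4 * INR m) * (Hs' (pred m) t - Hs (pred m) t)) by ring.
    replace (x * x) with (2 * t) by (unfold t; field).
    replace (- (2 * t) * exp (- t) * (4 * INR m) * (Hs' (pred m) t - Hs (pred m) t))
      with (- exp (- t) * (4 * INR m) * (2 * t * Hs' (pred m) t - 2 * t * Hs (pred m) t)) by ring.
    replace (2 * t * Hs' (pred m) t) with (Hq (pred m) t - Hs (pred m) t)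
      by (rewrite <- Hs_Hq; ring).
    destruct m as [|m]; [simpl INR; ring|].
    replace (Hq (pred (S m)) t) with (Hq (S m) t + 4 * t * Hs m t)
      by (rewrite Hq_step; simpl pred; ring).
    simpl pred. ring.
Qed.

(* Sonin's function [f^2 + f'^2 / (lam - x^2)] increases where [x^2 < lam], so the
   successive maxima of a solution of [f'' = (x^2 - lam) f] increase with [x];
   beyond [sqrt lam] a positive solution is convex and has no maximum. *)
Lemma sonin_max (f f' : R -> R) lam a b X :
  (forall x, is_derive f x (f' x)) ->
  (forall x, is_derive f' x ((x * x - lam) * f x)) ->
  f' 0 = 0 -> 0 <= a -> a < X < b -> f' X = 0 -> 0 < f X ->
  (forall x, a <= x <= b -> f x <= f X) -> f 0 * f 0 <= f X * f X.
Proof.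
  intros Hf Hf' F0 Ha HX FX PX Hmax.
  assert (Xlam : X * X < lam).
  { apply Rnot_le_lt; intros Hle.
    assert (C := is_derive_continuity _ _ _ (Hf X)).
    destruct (C (f X) PX) as [del [del0 Hdel]].
    set (r := Rmin (del / 2) (b - X)).
    assert (R1 : r <= del / 2) by apply Rmin_l. assert (R2 : r <= b - X) by apply Rmin_r.
    assert (R0 : 0 < r) by (apply Rmin_glb_lt; lra).
    assert (pos : forall x, X < x <= X + r -> 0 < f x).
    { intros x Hx. assert (B : Rabs (f x - f X) < f X).
      { apply (Hdel x). split; [split; [exact I|lra]|].
        simpl. unfold Rdist. rewrite Rabs_pos_eq; lra. }
      apply Rabs_def2 in B. lra. }
    destruct (MVT_is_derive f f' X (X + r)) as [y [Ey Hy]]; [lra|intros; apply Hf|].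
    destruct (MVT_is_derive f' (fun x => (x * x - lam) * f x) X y) as [z [Ez Hz]];
      [lra|intros; apply Hf'|].
    assert (Pz := pos z ltac:(lra)).
    assert (0 < z * z - lam) by nra.
    assert (0 < f' y).
    { rewrite FX in Ez. assert (0 < (z * z - lam) * f z * (y - X)).
      { apply Rmult_lt_0_compat; [apply Rmult_lt_0_compat|]; lra. } lra. }
    assert (M := Hmax (X + r) ltac:(lra)).
    assert (0 < f' y * (X + r - X)) by (apply Rmult_lt_0_compat; lra). lra. }
  destruct (MVT_is_derive (fun x => f x * f x + f' x * f' x / (lam - x * x))
    (fun x => 2 * x * (f' x * f' x) / ((lam - x * x) * (lam - x * x))) 0 X)
    as [c [Ec Hc]]; [lra| |].
  - intros x Hx. assert (N : lam - x * x <> 0) by nra.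
    replace (2 * x * (f' x * f' x) / ((lam - x * x) * (lam - x * x)))
      with ((f' x * f x + f x * f' x) +
        (((((x * x - lam) * f x) * f' x + f' x * ((x * x - lam) * f x)) * (lam - x * x)
        - (f' x * f' x) * (- 2 * x)) / (lam - x * x) ^ 2)) by (field; exact N).
    apply (is_derive_plus (V := R_NormedModule) (fun x => f x * f x)
      (fun x => f' x * f' x / (lam - x * x))).
    + apply (is_derive_mult f f); [apply Hf|apply Hf|intros; apply Rmult_comm].
    + apply (is_derive_div (fun x => f' x * f' x) (fun x => lam - x * x)); [| |exact N].
      * apply (is_derive_mult f' f'); [apply Hf'|apply Hf'|intros; apply Rmult_comm].
      * auto_derive; [auto|ring].
  - rewrite FX, F0 in Ec.
    assert (0 <= 2 * c * (f' c * f' c) / ((lam - c * c) * (lam - c * c)) * (X - 0)).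
    { apply Rmult_le_pos; [|lra]. apply Rdiv_le_0_compat.
      - apply Rmult_le_pos; [lra|apply Rle_0_sqr].
      - assert (0 < lam - c * c) by nra. now apply Rmult_lt_0_compat. }
    unfold Rdiv in Ec at 1 2. lra.
Qed.

(** Each interval between consecutive zeros holds an extremum of the required sign, of modulus at
    least [hermite m 0 = 1] by Sonin's argument. Together with 0 these extrema, mapped by [x^2 / 2],
    are the nodes. *)
Lemma hermite_alternance m :
  exists t, nodes (S m) t /\
    forall i, (i < S m)%nat -> 1 <= 1 * (-1) ^ i * (exp (- t i) * polyv (S m) (hq m) (t i)).
Proof.
  destruct (Hq_alternates m) as [u [U0 [U1 U2]]].
  assert (U3 : forall i, (i <= m)%nat -> 0 < (-1) ^ i * hermite m (u i)).
  { intros i Hi. unfold hermite. assert (P := exp_pos (- (u i * u i / 2))).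
    specialize (U2 i Hi). nra. }
  assert (Van : vanishing (hermite m)).
  { apply (vanishing_half_sqr (fun t => exp (- t) * Hq m t)), vanishing_laguerre. }
  destruct (Van ((-1) ^ m * hermite m (u m)) (U3 m (le_n _))) as [A [A0 HA]].
  set (B := Rmax A (u m + 1)).
  assert (B1 : A <= B) by apply Rmax_l. assert (B2 : u m + 1 <= B) by apply Rmax_r.
  destruct (finite_choice (fun i z => u i < z < u (S i) /\ hermite m z = 0) 0 m) as [z Hz].
  { intros i Hi.
    destruct (IVT_cor (hermite m) (u i) (u (S i))) as [z [Z1 Z2]].
    - intros x; eapply is_derive_continuity, is_derive_hermite.
    - apply Rlt_le, U1, Hi.
    - assert (P := U3 i ltac:(lia)). assert (Q := U3 (S i) ltac:(lia)).
      assert (R := sign_sqr i). simpl pow in Q.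
      replace (hermite m (u i) * hermite m (u (S i)))
        with (- (((-1) ^ i * hermite m (u i)) * (-1 * (-1) ^ i * hermite m (u (S i))))
          / ((-1) ^ i * (-1) ^ i)) by (field; apply pow_nonzero; lra).
      rewrite R. nra.
    - exists z; split; [|exact Z2].
      assert (P := U3 i ltac:(lia)). assert (Q := U3 (S i) ltac:(lia)).
      split; apply Rnot_le_lt; intros Hle.
      + replace (u i) with z in P by lra. rewrite Z2 in P. lra.
      + replace (u (S i)) with z in Q by lra. rewrite Z2 in Q. lra. }
  (* The far point [B], where the function is below its value at [u m] in modulus, closes the last
     interval in place of a zero. *)
  set (z' := fun i => if Nat.eq_dec i m then B else z i).
  assert (main : forall i, (S i <= m)%nat -> exists X,
    z' i < X < z' (S i) /\ 1 <= (-1) ^ S i * hermite m X).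
  { intros i Hi. set (f := fun x => (-1) ^ S i * hermite m x).
    assert (Ez : z' i = z i) by (unfold z'; destruct (Nat.eq_dec i m); [lia|reflexivity]).
    destruct (Hz i ltac:(lia)) as [Z1 Z2].
    assert (P := U3 (S i) Hi). fold (f (u (S i))) in P.
    destruct (interior_max f (fun x => (-1) ^ S i * hermite' m x) (z' i) (z' (S i)) (u (S i)))
      as [X [HX [D [L Hmax]]]].
    - intros x. apply is_derive_scal, is_derive_hermite.
    - rewrite Ez. split; [lra|]. unfold z'. destruct (Nat.eq_dec (S i) m) as [<-|].
      + lra.
      + apply (Hz (S i)); lia.
    - rewrite Ez. unfold f at 1. rewrite Z2, Rmult_0_r. exact P.
    - unfold z'. destruct (Nat.eq_dec (S i) m) as [E|].
      + specialize (HA B B1).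
        apply Rle_lt_trans with (Rabs (hermite m B)); [|unfold f; rewrite E; exact HA].
        eapply Rle_trans; [apply Rle_abs|]. unfold f.
        rewrite Rabs_mult, Rabs_sign. lra.
      + unfold f at 1. rewrite (proj2 (Hz (S i) ltac:(lia))), Rmult_0_r. exact P.
    - exists X; split; [exact HX|].
      assert (S0 := sonin_max f (fun x => (-1) ^ S i * hermite' m x) (4 * INR m + 1)
        (z' i) (z' (S i)) X).
      assert (F0 : f 0 * f 0 = 1).
      { unfold f. replace (hermite m 0) with 1.
        - rewrite Rmult_1_r. apply sign_sqr.
        - unfold hermite. replace (0 * 0 / 2) with 0 by field.
          rewrite Hq_at_0, Ropp_0, exp_0. ring. }
      rewrite F0 in S0. fold (f X). apply Rnot_lt_le; intros Hlt.
      assert (1 <= f X * f X); [|nra].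
      apply S0; auto; try lra.
      + intros x. apply is_derive_scal, is_derive_hermite.
      + intros x. unfold f.
        replace ((x * x - (4 * INR m + 1)) * ((-1) ^ S i * hermite m x))
          with ((-1) ^ S i * ((x * x - (4 * INR m + 1)) * hermite m x)) by ring.
        apply is_derive_scal, is_derive_hermite'.
      + unfold hermite'. ring.
      + rewrite Ez. assert (0 <= u i); [|lra].
        destruct i as [|i]; [exact U0|]. eapply Rle_trans; [exact U0|].
        apply Rlt_le, (increasing_lt u (S m)); [intros; apply U1; lia|lia]. }
  destruct (finite_choice (fun i X => z' i < X < z' (S i) /\ 1 <= (-1) ^ S i * hermite m X) 0 m)
    as [X HX].
  { intros i Hi; apply main; lia. }
  set (X' := fun i => match i with O => 0 | S j => X j end).
  assert (Xinc : forall i, (i < m)%nat -> X' i < X' (S i)).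
  { intros [|i] Hi; simpl.
    - destruct (HX O Hi) as [HX0 _]. destruct (Hz O Hi) as [HZ0 _].
      unfold z' in HX0 at 1. destruct (Nat.eq_dec 0 m); [lia|]. lra.
    - destruct (HX i ltac:(lia)) as [HX1 _]. destruct (HX (S i) Hi) as [HX2 _]. lra. }
  assert (Xpos : forall i, (i <= m)%nat -> 0 <= X' i).
  { intros [|i] Hi; [simpl; lra|]. apply Rlt_le, (increasing_lt X' (S m) ltac:(intros; apply Xinc; lia) O). lia. }
  exists (fun i => X' i * X' i / 2). split.
  - split; [simpl; field|]. intros j Hj.
    assert (P := Xpos j ltac:(lia)). assert (Q := Xinc j ltac:(lia)). nra.
  - intros i Hi. fold (Hq m). rewrite Rmult_1_l. fold (hermite m (X' i)).
    destruct i as [|i].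
    + unfold X', hermite. replace (0 * 0 / 2) with 0 by field.
      rewrite Hq_at_0, Ropp_0, exp_0. simpl; lra.
    + apply HX; lia.
Qed.

(** * A polynomial with large derivatives *)

(* With [Y(t) = exp (- t) * Hs m t], the function is [Y + 2 t Y'], i.e. the derivative
   in [x] of the odd Hermite function [x * Y (x^2 / 2)]. *)
Lemma lower_witness_bounded m s : 0 <= s ->
  Rabs (exp (- s) * polyv (S (S m)) (fun k => (hq (S m) k + hq m k) / 2) s) <= 1.
Proof.
  set (c := fun k => (hq (S m) k + hq m k) / 2).
  set (D := fun t => exp (- t) * polyv (S (S m)) c t).
  (* The constant [2 d + 1] of Hermite's equation for the odd degree [d = 2 m + 1]. *)
  set (lam := 4 * INR (S m) - 1).
  set (Y := fun t => exp (- t) * Hs m t).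
  assert (DE : forall t, exp (- t) * (Hq (S m) t + 2 * t * Hs m t) = D t).
  { intros t. unfold D. f_equal.
    replace (Hq (S m) t + 2 * t * Hs m t) with ((Hq (S m) t + Hq m t) / 2)
      by (rewrite Hq_step; field).
    assert (E : Hq m t = polyv (S (S m)) (hq m) t).
    { unfold Hq. rewrite (polyv_S (S m)), (hq_gt m (S m)) by lia. ring. }
    rewrite E. unfold Hq, polyv. unfold Rdiv. rewrite Rmult_comm, <- rsum_plus, <- rsum_scal.
    apply rsum_ext; intros; unfold c; field. }
  assert (HD : forall t, is_derive D t (- (lam - 2 * t) * Y t)).
  { intros t. apply (is_derive_ext _ _ _ _ DE). unfold Y, lam.
    replace (- (4 * INR (S m) - 1 - 2 * t) * (exp (- t) * Hs m t))
      with (- exp (- t) * (Hq (S m) t + 2 * t * Hs m t)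
        + exp (- t) * (- 4 * INR (S m) * Hs m t + (2 * Hs m t + 2 * t * Hs' m t))).
    - apply (is_derive_mult (fun t => exp (- t)) (fun t => Hq (S m) t + 2 * t * Hs m t));
        [auto_derive; [auto|ring]| |intros; apply Rmult_comm].
      apply (is_derive_plus (V := R_NormedModule) (Hq (S m)) (fun t => 2 * t * Hs m t));
        [apply is_derive_Hq_S|].
      apply (is_derive_mult (fun t => 2 * t) (Hs m));
        [auto_derive; [auto|ring]|apply is_derive_Hs|intros; apply Rmult_comm].
    - replace (2 * t * Hs' m t) with (Hq m t - Hs m t) by (rewrite <- Hs_Hq; ring).
      rewrite Hq_step. ring. }
  assert (HY : forall t, is_derive Y t (exp (- t) * (Hs' m t - Hs m t))).
  { intros t. unfold Y.
    replace (exp (- t) * (Hs' m t - Hs m t))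
      with (- exp (- t) * Hs m t + exp (- t) * Hs' m t) by ring.
    apply (is_derive_mult (fun t => exp (- t)) (Hs m));
      [auto_derive; [auto|ring]|apply is_derive_Hs|intros; apply Rmult_comm]. }
  (* For the odd Hermite function [f] in the variable [x], this is [f'^2 + (lam - x^2) f^2], with
     derivative [- 2 x f^2]. At a critical point of [D] the second term vanishes, so
     [D^2 <= En 0 = 1]. *)
  set (En := fun t => D t * D t + (lam - 2 * t) * (2 * t) * (Y t * Y t)).
  assert (HEn : forall t, is_derive En t (- 4 * t * (Y t * Y t))).
  { intros t. unfold En.
    replace (- 4 * t * (Y t * Y t))
      with ((- (lam - 2 * t) * Y t * D t + D t * (- (lam - 2 * t) * Y t))
        + ((2 * lam - 8 * t) * (Y t * Y t) + (lam - 2 * t) * (2 * t) *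
          ((exp (- t) * (Hs' m t - Hs m t)) * Y t + Y t * (exp (- t) * (Hs' m t - Hs m t))))).
    - apply (is_derive_plus (V := R_NormedModule) (fun t => D t * D t)
        (fun t => (lam - 2 * t) * (2 * t) * (Y t * Y t))).
      + apply (is_derive_mult D D); [apply HD|apply HD|intros; apply Rmult_comm].
      + apply (is_derive_mult (fun t => (lam - 2 * t) * (2 * t)) (fun t => Y t * Y t));
          [auto_derive; [auto|ring]| |intros; apply Rmult_comm].
        apply (is_derive_mult Y Y); [apply HY|apply HY|intros; apply Rmult_comm].
    - rewrite <- DE.
      replace (Hq (S m) t + 2 * t * Hs m t) with (Hs m t + 2 * t * Hs' m t - 2 * t * Hs m t)
        by (rewrite Hs_Hq, Hq_step; ring).
      unfold Y. ring. }
  assert (D0 : D 0 = 1).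
  { rewrite <- DE, Ropp_0, exp_0, Hq_at_0. ring. }
  assert (En1 : forall t, 0 <= t -> En t <= 1).
  { intros t Ht. replace 1 with (En 0) by (unfold En; rewrite D0; ring).
    destruct Ht as [Ht|<-]; [|lra].
    destruct (MVT_is_derive En (fun t => - 4 * t * (Y t * Y t)) 0 t Ht) as [x [Ex Hx]];
      [intros; apply HEn|].
    assert (0 <= x * (Y x * Y x) * (t - 0)).
    { apply Rmult_le_pos; [|lra]. apply Rmult_le_pos; [lra|apply Rle_0_sqr]. }
    lra. }
  intros Hs. fold (D s). apply Rnot_lt_le; intros Hlt.
  destruct (vanishing_extremum D (fun t => - (lam - 2 * t) * Y t) s HD) as [X [X0 [E L]]].
  - apply vanishing_laguerre.
  - exact Hs.
  - rewrite D0, Rabs_R1. exact Hlt.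
  - assert (B := En1 X (Rlt_le _ _ X0)). unfold En in B.
    replace ((lam - 2 * X) * (2 * X) * (Y X * Y X))
      with (- (- (lam - 2 * X) * Y X) * (2 * X) * Y X) in B by ring.
    rewrite E in B. assert (C : Rabs (D X) * Rabs (D X) = D X * D X).
    { rewrite <- Rabs_mult. apply Rabs_pos_eq, Rle_0_sqr. }
    nra.
Qed.

(** * Derivatives at 0 as binomial sums *)

(** At [t = 0] the mixed derivative is the [k]-th derivative of [(- lam)^l], here taken at
    [lam = 1]. *)
Lemma dexp_1_0 l : forall k, dexp k l 1 0 = (-1) ^ l * (INR (fact k) * INR (binom l k)).
Proof.
  induction l as [|l IH]; intros k.
  - destruct k; simpl; rewrite ?Rmult_0_r, ?Ropp_0, exp_0; simpl; ring.
  - cbn [dexp]. rewrite !IH. destruct k as [|k].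
    + rewrite !binom_n_0. simpl; ring.
    + rewrite binom_S_S, plus_INR, fact_simpl, mult_INR. simpl pred. simpl pow. ring.
Qed.

Lemma Derive_n_laguerre_0 n c l :
  Derive_n (fun t => exp (- t) * polyv n c t) l 0
  = (-1) ^ l * rsum (fun k => c k * ((-1) ^ k * (INR (fact k) * INR (binom l k)))) n.
Proof.
  rewrite Derive_n_laguerre. unfold quasi. rewrite <- rsum_scal.
  apply rsum_ext; intros k _. rewrite dexp_1_0. ring.
Qed.

Lemma sum_f_R0_rsum f l : sum_f_R0 f l = rsum f (S l).
Proof. induction l as [|l IH]; simpl in *; [ring|rewrite IH; ring]. Qed.

Lemma rsum_extend f n N :
  (n <= N)%nat -> (forall k, (n <= k < N)%nat -> f k = 0) -> rsum f N = rsum f n.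
Proof.
  intros H; induction H as [|N H IH]; intros H0; [reflexivity|].
  simpl. rewrite IH, H0 by (lia || (intros; apply H0; lia)). ring.
Qed.

(** The coefficients run up to the degree [m], the stated sums up to [l]; the two binomial factors
    vanish beyond these bounds. *)
Lemma rsum_binom_truncate (f : nat -> R) m l :
  (forall k, (m < k)%nat -> f k = 0) -> (forall k, (l < k)%nat -> f k = 0) ->
  rsum f (S m) = sum_f_R0 f l.
Proof.
  intros H1 H2. rewrite sum_f_R0_rsum. destruct (Nat.le_ge_cases m l).
  - symmetry; apply rsum_extend; [lia|]. intros; apply H1; lia.
  - apply rsum_extend; [lia|]. intros; apply H2; lia.
Qed.

Lemma hq_sign m k :
  hq m k * ((-1) ^ k * INR (fact k)) = 8 ^ k * INR (binom m k) / INR (binom (2 * k) k).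
Proof.
  unfold hq. assert (P := central_binom_pos k). assert (Q := INR_fact_lt_0 k).
  replace ((-1) ^ k * 8 ^ k * INR (binom m k) / (INR (binom (2 * k) k) * INR (fact k))
    * ((-1) ^ k * INR (fact k)))
    with (((-1) ^ k * (-1) ^ k) * 8 ^ k * INR (binom m k) / INR (binom (2 * k) k))
    by (field; lra).
  rewrite sign_sqr. field. lra.
Qed.

Lemma Derive_n_upper m l :
  Derive_n (fun t => exp (- t) * polyv (S m) (hq m) t) l 0
  = (-1) ^ l * sum_f_R0 (fun j => 8 ^ j * INR (binom m j) * INR (binom l j)
                     / INR (binom (2 * j) j)) l.
Proof.
  rewrite Derive_n_laguerre_0. f_equal.
  rewrite <- (rsum_binom_truncate _ m).
  - apply rsum_ext; intros k _.
    replace (hq m k * ((-1) ^ k * (INR (fact k) * INR (binom l k))))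
      with (hq m k * ((-1) ^ k * INR (fact k)) * INR (binom l k)) by ring.
    rewrite hq_sign. unfold Rdiv; ring.
  - intros k Hk. rewrite binom_gt by exact Hk. simpl INR. unfold Rdiv; ring.
  - intros k Hk. rewrite (binom_gt l) by exact Hk. simpl INR. unfold Rdiv; ring.
Qed.

(** The factor [1 - j / (2 (m + 1))] is the mean of 1 and [1 - j / (m + 1)], the latter being the
    ratio of [binom m j] to [binom (S m) j]. *)
Lemma Derive_n_lower m l :
  Derive_n (fun t => exp (- t) * polyv (S (S m)) (fun k => (hq (S m) k + hq m k) / 2) t) l 0
  = (-1) ^ l * sum_f_R0 (fun j => (1 - INR j / (2 * INR (S m))) *
      (8 ^ j * INR (binom (S m) j) * INR (binom l j) / INR (binom (2 * j) j))) l.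
Proof.
  rewrite Derive_n_laguerre_0. f_equal.
  assert (P : 0 < INR (S m)) by (apply lt_0_INR; lia).
  rewrite <- (rsum_binom_truncate _ (S m)).
  - apply rsum_ext; intros k _.
    replace ((hq (S m) k + hq m k) / 2 * ((-1) ^ k * (INR (fact k) * INR (binom l k))))
      with ((hq (S m) k * ((-1) ^ k * INR (fact k)) + hq m k * ((-1) ^ k * INR (fact k)))
         * INR (binom l k) / 2) by field.
    rewrite !hq_sign. assert (A := binom_absorb_up m k).
    replace (INR (binom m k)) with ((INR (S m) - INR k) * INR (binom (S m) k) / INR (S m))
      by (rewrite A; field; lra).
    assert (Q := central_binom_pos k). field. lra.
  - intros k Hk. rewrite binom_gt by exact Hk. simpl (INR 0). unfold Rdiv; ring.
  - intros k Hk. rewrite (binom_gt l) by exact Hk. simpl (INR 0). unfold Rdiv; ring.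
Qed.

(** * The extremal constant *)

Lemma inRP_bounded n h p :
  inI n h -> inRP n h p -> exists M, forall t, 0 <= t -> Rabs (p t) <= M.
Proof.
  intros Hh [a Ha].
  destruct (finite_choice (fun i C => forall t, 0 <= t -> basis h i t <= C) 0 n) as [C HC].
  { intros i Hi. apply pow_exp_bounded, Hh, Hi. }
  exists (rsum (fun i => Rabs (a i) * C i) n). intros t Ht. rewrite Ha.
  eapply Rle_trans; [apply Rabs_rsum|]. apply rsum_le. intros i Hi.
  rewrite Rabs_mult. apply Rmult_le_compat_l; [apply Rabs_pos|].
  rewrite Rabs_pos_eq; [now apply HC|].
  apply Rmult_le_pos; [now apply pow_le|apply Rlt_le, exp_pos].
Qed.

Lemma inRP_scal n h p k : inRP n h p -> inRP n h (fun t => k * p t).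
Proof.
  intros [a Ha]. exists (fun i => k * a i). intros t.
  rewrite Ha, <- rsum_scal. apply rsum_ext; intros; ring.
Qed.

Lemma inI_1 n : inI n (fun _ => 1).
Proof. intros i _; lra. Qed.

Lemma inRP_laguerre n c : inRP n (fun _ => 1) (fun t => exp (- t) * polyv n c t).
Proof.
  exists c. intros t. unfold polyv. rewrite <- rsum_scal.
  apply rsum_ext; intros i _. unfold basis.
  replace (Defs.mult (fun _ => 1) 1 i) with i.
  - replace (- (1) * t) with (- t) by ring. ring.
  - induction i as [|i IH]; simpl; [reflexivity|].
    destruct (Req_EM_T 1 1); [lia|lra].
Qed.

Definition derivative_at_0 (l n : nat) (c : nat -> R) : R :=
  Rabs (Derive_n (fun t => exp (- t) * polyv n c t) l 0).

Lemma chebR_comparison l n c h p s :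
  (1 <= n)%nat -> is_chebR n c ->
  inI n h -> inRP n h p -> (forall t, 0 <= t -> Rabs (p t) <= 1) -> 0 <= s ->
  Rabs (Derive_n p l s) <= derivative_at_0 l n c.
Proof.
  intros Hn [_ [_ [t [sg [Hsg [H0 [Ht Hv]]]]]]] Hh Hp Hb Hs. apply (comparison l n t sg c h p s); auto.
  - now split.
  - destruct Hsg as [->| ->]; [apply Rabs_R1|rewrite Rabs_left; lra].
  - intros i Hi. rewrite Hv by exact Hi. right.
    replace (sg * (-1) ^ i * (sg * (-1) ^ i)) with (sg * sg * ((-1) ^ i * (-1) ^ i)) by ring.
    rewrite sign_sqr. destruct Hsg as [->| ->]; ring.
Qed.

Lemma chebR_markov l n c h p s :
  (1 <= n)%nat -> is_chebR n c ->
  inI n h -> inRP n h p -> 0 <= s ->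
  Rabs (Derive_n p l s) <= derivative_at_0 l n c * supnorm p.
Proof.
  intros Hn Hc Hh Hp Hs. set (K := derivative_at_0 l n c).
  destruct (inRP_bounded n h p Hh Hp) as [M HM].
  assert (Hb := fun t => le_supnorm p M t HM).
  assert (N0 : 0 <= supnorm p) by (eapply Rle_trans; [apply Rabs_pos|apply (Hb 0); lra]).
  assert (K0 : 0 <= K) by apply Rabs_pos.
  (* The norm of [p] may be 0, so [p] is divided by any [mu] above it; [mu] then decreases to the
     norm, with [K + 1] guarding against [K = 0]. *)
  assert (main : forall mu, supnorm p < mu -> Rabs (Derive_n p l s) <= K * mu).
  { intros mu Hmu. assert (mu0 : 0 < mu) by lra.
    assert (A := chebR_comparison l n c h (fun t => / mu * p t) s Hn Hc Hh (inRP_scal n h p _ Hp)).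
    fold K in A. rewrite Derive_n_scal_l, Rabs_mult, Rabs_inv, (Rabs_pos_eq mu) in A by lra.
    apply (Rmult_le_reg_l (/ mu)); [now apply Rinv_0_lt_compat|].
    replace (/ mu * (K * mu)) with K by (field; lra).
    apply A; [|exact Hs]. intros t Ht. specialize (Hb t Ht).
    rewrite Rabs_mult, Rabs_inv, (Rabs_pos_eq mu) by lra.
    apply (Rmult_le_reg_l mu); [exact mu0|]. rewrite <- Rmult_assoc, Rinv_r; lra. }
  apply le_epsilon. intros eps Heps.
  eapply Rle_trans; [apply (main (supnorm p + eps / (K + 1)))|].
  - assert (0 < eps / (K + 1)) by (apply Rdiv_lt_0_compat; lra). lra.
  - rewrite Rmult_plus_distr_l. apply Rplus_le_compat_l.
    apply (Rmult_le_reg_r (K + 1)); [lra|].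
    replace (K * (eps / (K + 1)) * (K + 1)) with (K * eps) by (field; lra). nra.
Qed.

Lemma chebR_bounded n c t :
  is_chebR n c -> 0 <= t -> Rabs (exp (- t) * polyv n c t) <= 1.
Proof.
  intros [_ [<- _]] Ht.
  destruct (inRP_bounded n _ _ (inI_1 n) (inRP_laguerre n c)) as [M HM].
  now apply (le_supnorm (fun t => exp (- t) * polyv n c t) M).
Qed.

Lemma supnorm_Derive_n_le l n c h p :
  (1 <= n)%nat -> is_chebR n c ->
  inI n h -> inRP n h p -> supnorm (Derive_n p l) <= derivative_at_0 l n c * supnorm p.
Proof. intros Hn Hc Hh Hp. apply supnorm_le. intros s. now apply (chebR_markov l n c h). Qed.

Lemma supnorm_Derive_n_chebR l n c :
  (1 <= n)%nat -> is_chebR n c ->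
  supnorm (Derive_n (fun t => exp (- t) * polyv n c t) l) = derivative_at_0 l n c.
Proof.
  intros Hn Hc.
  assert (A : forall s, 0 <= s -> Rabs (Derive_n (fun t => exp (- t) * polyv n c t) l s)
    <= derivative_at_0 l n c).
  { intros s Hs. apply (chebR_comparison l n c (fun _ => 1));
      auto using inI_1, inRP_laguerre, chebR_bounded. }
  apply Rle_antisym; [now apply supnorm_le|].
  apply (le_supnorm _ _ 0 A); lra.
Qed.

Lemma m_l_spec l n c h : (1 <= n)%nat -> is_chebR n c -> inI n h ->
  (forall p, inRP n h p -> supnorm p <= 1 -> supnorm (Derive_n p l) <= m_l l n h) /\
  m_l l n h <= derivative_at_0 l n c.
Proof.
  intros Hn Hc Hh. set (K := derivative_at_0 l n c).
  destruct (real_Lub_Rbar (fun y => exists p, inRP n h p /\ supnorm p <= 1 /\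
    y = supnorm (Derive_n p l)) (supnorm (Derive_n (fun _ => 0) l)) K) as [A B].
  - exists (fun _ => 0). repeat split.
    + exists (fun _ => 0). intros t. symmetry; apply rsum_0; intros; ring.
    + apply supnorm_le. intros; rewrite Rabs_R0; lra.
  - intros y [p [Hp [Hp1 ->]]]. eapply Rle_trans; [apply (supnorm_Derive_n_le l n c h p Hn Hc Hh Hp)|].
    fold K. rewrite <- (Rmult_1_r K) at 2. apply Rmult_le_compat_l; [apply Rabs_pos|exact Hp1].
  - split; [|exact B]. intros p Hp Hp1. apply A. now exists p.
Qed.

(** The comparison bounds every [m_l l n h] by the same constant, and the Chebyshev function itself
    is admissible at [h = (1,...,1)]. *)
Lemma m_ln_chebR l n c :
  (1 <= n)%nat -> is_chebR n c -> m_ln l n = derivative_at_0 l n c.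
Proof.
  intros Hn Hc. set (K := derivative_at_0 l n c).
  destruct (real_Lub_Rbar (fun y => exists h, inI n h /\ y = m_l l n h)
    (m_l l n (fun _ => 1)) K) as [A B].
  - exists (fun _ => 1). split; [apply inI_1|reflexivity].
  - intros y [h [Hh ->]]. now apply m_l_spec.
  - apply Rle_antisym; [exact B|].
    unfold K. rewrite <- (supnorm_Derive_n_chebR l n c Hn Hc).
    apply Rle_trans with (m_l l n (fun _ => 1)).
    + apply (m_l_spec l n c); auto using inI_1, inRP_laguerre.
      apply supnorm_le. intros t. now apply chebR_bounded.
    + apply A. exists (fun _ => 1). split; [apply inI_1|reflexivity].
Qed.

Theorem theorem3 (l n : nat) (Hn : (2 <= n)%nat) :
  (forall h : nat -> R, inI n h ->
     forall p : R -> R, inRP n h p ->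
       supnorm (Derive_n p l) <= m_ln l n * supnorm p) /\
  (exists c, is_chebR n c) /\
  (forall c, is_chebR n c ->
     supnorm (Derive_n (fun t => exp (- t) * polyv n c t) l)
     = m_ln l n * supnorm (fun t => exp (- t) * polyv n c t)) /\
  sum_f_R0 (fun j => (1 - INR j / (2 * INR (n - 1))) *
                     (8 ^ j * INR (binom (n - 1) j) * INR (binom l j)
                      / INR (binom (2 * j) j))) l
    <= m_ln l n /\
  m_ln l n <=
  sum_f_R0 (fun j => 8 ^ j * INR (binom (n - 1) j) * INR (binom l j)
                     / INR (binom (2 * j) j)) l.
Proof.
  assert (n1 : (1 <= n)%nat) by lia.
  destruct (chebR_exists n Hn) as [c Hc].
  split; [|split; [now exists c|split; [|split]]].
  - intros h Hh p Hp. rewrite (m_ln_chebR l n c n1 Hc).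
    now apply (supnorm_Derive_n_le l n c h).
  - intros c' Hc'. rewrite (m_ln_chebR l n c' n1 Hc'), supnorm_Derive_n_chebR by auto.
    destruct Hc' as [_ [-> _]]. ring.
  - destruct n as [|[|m]]; [lia|lia|]. replace (S (S m) - 1)%nat with (S m) by lia.
    rewrite (m_ln_chebR l (S (S m)) c n1 Hc).
    assert (E := f_equal Rabs (Derive_n_lower m l)).
    rewrite Rabs_mult, Rabs_sign, Rmult_1_l in E.
    eapply Rle_trans; [apply Rle_abs|]. rewrite <- E.
    apply (chebR_comparison l (S (S m)) c (fun _ => 1)); auto using inI_1, inRP_laguerre.
    + apply lower_witness_bounded.
    + lra.
  - destruct n as [|m]; [lia|]. replace (S m - 1)%nat with m by lia.
    rewrite (m_ln_chebR l (S m) c n1 Hc).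
    (* Here the Chebyshev function is the one being estimated and the Hermite function is the
       comparison function. *)
    destruct (hermite_alternance m) as [t [Ht Hv]].
    eapply Rle_trans;
      [apply (comparison l (S m) t 1 (hq m) (fun _ => 1)); auto using inI_1, inRP_laguerre, Rabs_R1|].
    + intros u Hu. now apply chebR_bounded.
    + lra.
    + rewrite Derive_n_upper, Rabs_mult, Rabs_sign, Rmult_1_l, Rabs_pos_eq; [lra|].
      apply cond_pos_sum. intros k. apply Rdiv_le_0_compat; [|apply central_binom_pos].
      repeat apply Rmult_le_pos; try apply pos_INR. apply pow_le; lra.
Qed.
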